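(* For every fixed $k\ge1$, there exists a fully polynomial-time randomized approximation scheme (FPRAS) for $k$-criteria ACC, i.e., an algorithm that, given a directed graph $G=(V,E)$ with $k$ edge weight functions $w_1,\dots,w_k:E\to\mathbb{N}$ and $\varepsilon>0$, runs in time polynomial in the input size and $1/\varepsilon$ and, with probability at least $1/2$, outputs a $(1+\varepsilon)$-approximate Pareto curve of cycle covers of $G$.
   Context: A cycle cover of a directed graph $G=(V,E)$ is a set $C\subseteq E$ of edges such that $(V,C)$ consists of vertex-disjoint directed cycles with every vertex in exactly one cycle. $k$-criteria ACC: feasible solutions are the cycle covers $C$ of $G$, and all objectives $w_i(C)=\sum_{e\in C}w_i(e)$ are to be minimized. A set $P$ of feasible solutions is a $\rho$-approximate Pareto curve if for every feasible solution $z$ there is $y\in P$ with $w_i(y)\le\rho\,w_i(z)$ for all $i\in\{1,\dots,k\}$. *)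

(* Defs.v *)
From HB Require Import structures.
From mathcomp Require Import all_boot all_order all_algebra.
From mathcomp Require Import boolp.

Set Implicit Arguments.
Unset Strict Implicit.
Unset Printing Implicit Defensive.

Import Order.TTheory GRing.Theory Num.Theory.
Local Open Scope ring_scope.

(* A directed graph on V is its edge set E : {set V * V}. A loop is allowed and
   is then a directed cycle of length one. *)
Section CycleCover.
Variable V : finType.

(* The edges of the directed cycle that visits the vertices of [c] in order and
   returns to its first vertex. *)
Definition cycle_edges (c : seq V) : {set V * V} :=
  [set:: [seq (v, next c v) | v <- c]].

Definition is_cycle_cover (E C : {set V * V}) : Prop :=
  C \subset E /\
  exists cs : seq (seq V),
    [/\ all (fun c => (c != [::]) && uniq c) cs,
        forall v : V, count (fun c : seq V => v \in c) cs = 1%N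
      & C = \bigcup_(c <- cs) cycle_edges c].

Definition edges_weight (we : V * V -> nat) (C : {set V * V}) : nat :=
  (\sum_(e in C) we e)%N.

End CycleCover.

Definition is_approx_pareto (S : finType) (k : nat) (feasible : S -> Prop)
    (obj : 'I_k -> S -> nat) (rho : rat) (P : {set S}) : Prop :=
  (forall y, y \in P -> feasible y) /\
  (forall z, feasible z ->
     exists2 y, y \in P &
       forall i : 'I_k, (obj i y)%:R <= rho * (obj i z)%:R).

(* A RAM has registers indexed by integers and holding integers (all 0 at the
   start), read-only access to the list of input numbers, an append-only
   output, and fair coins. Control flow is structured instead of by jumps. *)

Inductive expr :=
| Const of int
| Inp of expr          (* input number at the given position, 0 if none *)
| Reg of expr          (* register at the given address *)
| Add of expr & expr
| Sub of expr & expr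
| Mul of expr & expr
| Div of expr & expr.  (* Euclidean quotient, 0 if the divisor is 0 *)

Inductive cmd :=
| Skip
| Store of expr & expr (* address, value *)
| Flip of expr         (* stores a random bit at the given address *)
| Write of expr
| Seq of cmd & cmd
| If of expr & cmd & cmd   (* conditions test for a positive value *)
| While of expr & cmd.

Record state := State {
  regs : int -> int;
  coins : seq bool;    (* random bits not consumed yet *)
  output : seq int }.

(* floor (log2 |z|) + 1 for z <> 0, and 1 for z = 0 *)
Definition bitlen (z : int) : nat := (trunc_log 2 `|z|%N).+1.

Definition inp_at (x : seq int) (a : int) : int :=
  if a is Posz j then nth 0 x j else 0.

Section Machine.
Variable x : seq int.

Fixpoint value (m : int -> int) (e : expr) : int :=
  match e with
  | Const z => z
  | Inp e1 => inp_at x (value m e1)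
  | Reg e1 => m (value m e1)
  | Add e1 e2 => value m e1 + value m e2
  | Sub e1 e2 => value m e1 - value m e2
  | Mul e1 e2 => value m e1 * value m e2
  | Div e1 e2 => (value m e1 %/ value m e2)%Z
  end.

(* Every address, operand and result is charged its bit length. *)
Fixpoint ecost (m : int -> int) (e : expr) : nat :=
  (bitlen (value m e) +
   match e with
   | Const _ => 0
   | Inp e1 | Reg e1 => ecost m e1
   | Add e1 e2 | Sub e1 e2 | Mul e1 e2 | Div e1 e2 => ecost m e1 + ecost m e2
   end)%N.

Definition upd (m : int -> int) (a z : int) : int -> int :=
  fun b => if b == a then z else m b.

(* [exec c s t s']: from s, the command c halts in s' with logarithmic cost t.
   A coin flip is stuck when no random bit is left. *)
Inductive exec : cmd -> state -> nat -> state -> Prop :=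
| ExecSkip s : exec Skip s 1 s
| ExecStore a e m r o :
    exec (Store a e) (State m r o)
      (1 + ecost m a + ecost m e) (State (upd m (value m a) (value m e)) r o)
| ExecFlip a m (b : bool) r o :
    exec (Flip a) (State m (b :: r) o)
      (1 + ecost m a) (State (upd m (value m a) (b : nat)%:Z) r o)
| ExecWrite e m r o :
    exec (Write e) (State m r o)
      (1 + ecost m e) (State m r (rcons o (value m e)))
| ExecSeq c1 c2 s1 t1 s2 t2 s3 :
    exec c1 s1 t1 s2 -> exec c2 s2 t2 s3 -> exec (Seq c1 c2) s1 (t1 + t2) s3
| ExecIfTrue e c1 c2 s t s' :
    0 < value (regs s) e -> exec c1 s t s' ->
    exec (If e c1 c2) s (1 + ecost (regs s) e + t) s'
| ExecIfFalse e c1 c2 s t s' :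
    value (regs s) e <= 0 -> exec c2 s t s' ->
    exec (If e c1 c2) s (1 + ecost (regs s) e + t) s'
| ExecWhileTrue e c s1 t1 s2 t2 s3 :
    0 < value (regs s1) e ->
    exec c s1 t1 s2 -> exec (While e c) s2 t2 s3 ->
    exec (While e c) s1 (1 + ecost (regs s1) e + t1 + t2) s3
| ExecWhileFalse e c s :
    value (regs s) e <= 0 ->
    exec (While e c) s (1 + ecost (regs s) e) s.

(* Program A, started with the random bits r, halts within cost t with
   output o. *)
Definition outputs_within (A : cmd) (r : seq bool) (t : nat) (o : seq int) :
    Prop :=
  exists t' s', [/\ (t' <= t)%N,
    exec A (State (fun=> 0) r [::]) t' s' & output s' = o].

End Machine.

Definition prob (T : finType) (P : T -> Prop) : rat :=
  #|[set r | `[< P r >]]|%:R / #|T|%:R.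

Definition input_size (x : seq int) : nat := sumn (map bitlen x).

(* Accuracy (numerator, denominator), number of vertices, then the adjacency
   matrix row by row; the entry of a pair e consists of k + 1 numbers, namely
   the bit telling whether e is an edge and its k weights (0 for a non-edge). *)
Definition encode_instance (k n : nat) (E : {set 'I_n * 'I_n})
    (w : 'I_k -> 'I_n * 'I_n -> nat) (eps : rat) : seq int :=
  [:: numq eps, denq eps, n%:Z &
    flatten
      [seq ((u, v) \in E : nat)%:Z ::
             [seq (if (u, v) \in E then w i (u, v) else 0%N)%:Z
                | i <- enum 'I_k]
         | u <- enum 'I_n, v <- enum 'I_n]].

(* Each edge set is written as its number of edges followed by the endpoints of
   its edges, listed without repetition in any order. *)
Definition encode_edge_list (n : nat) (l : seq ('I_n * 'I_n)) : seq int :=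
  (size l)%:Z ::
    flatten [seq [:: (val e.1)%:Z; (val e.2)%:Z] | e <- l].

Definition encodes_family (n : nat) (o : seq int)
    (P : {set {set 'I_n * 'I_n}}) : Prop :=
  exists L : seq (seq ('I_n * 'I_n)),
    [/\ all uniq L,
        o = flatten (map (@encode_edge_list n) L)
      & P = [set:: [seq [set:: l] | l <- L]]].

(* A is a fully polynomial-time randomized approximation scheme for k-criteria
   cycle cover. The running time is bounded for every outcome of the coins; at
   most t coins can be flipped within cost t, so t random bits are supplied.
   The bound c (size + 1/eps)^d dominates, for suitable c and d, any polynomial
   in size and 1/eps because size >= 1. *)
Definition is_fpras_acc (k : nat) (A : cmd) : Prop :=
  exists c d : nat,
  forall (n : nat) (E : {set 'I_n * 'I_n}) (w : 'I_k -> 'I_n * 'I_n -> nat)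
    (eps : rat), 0 < eps ->
  let x := encode_instance E w eps in
  exists t : nat,
    [/\ t%:R <= c%:R * ((input_size x)%:R + eps^-1) ^+ d,
        forall r : t.-tuple bool, exists o, outputs_within x A r t o
      & 1 / 2 <= prob (fun r : t.-tuple bool =>
          exists o P, [/\ outputs_within x A r t o, encodes_family o P
            & is_approx_pareto (is_cycle_cover E)
                (fun i => edges_weight (w i)) (1 + eps) P])].

(* Main.v *)
(* The algorithm guesses the heaviest edge of the sought cycle cover for each
   objective and scales the weights accordingly: the scaled weights of its edges
   are at most n^2 / eps, so the k scaled weights of a cover fit into one
   polynomially bounded integer, its profile, and any cover with the profile of
   the sought one is at most 1 + eps times as heavy. It remains to find, for every
   profile that occurs, one cover having it. Each edge gets a random label;
   by the isolation lemma, with probability at least 1/2 every class of covers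
   with a common profile has a unique member of minimal label. The entries of a
   matrix are set to X^(profile * shift + label), so that det is a signed
   generating function of the covers, with X so large that it can be packed into
   an integer. The summand of an edge (u, v) in the expansion of det contains
   the exponent of an isolated cover iff the cover uses (u, v); all these
   summands are read off the adjugate, which the Faddeev-LeVerrier recursion
   computes. Exponents whose set of edges is not a cycle cover are dropped. *)

From HB Require Import structures.
From mathcomp Require Import all_boot all_order all_algebra all_fingroup.
From mathcomp Require Import boolp.
From mathcomp Require Import zify ring lra.
Require Import Defs.

Set Implicit Arguments.
Unset Strict Implicit.
Unset Printing Implicit Defensive.

Import Order.TTheory GRing.Theory Num.Theory.
Local Open Scope ring_scope.

(** * Weakest preconditions with resource bounds *)

(** The determinant stands in for an intractable permanent, so covers with equal exponents may
    cancel. A nonempty class therefore does not suffice; a unique minimal cover does, because its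
    coefficient is 1 or -1. All randomness sits in a single draw of labels that serves every guess
    and every profile. The label range pays for a union bound over these classes, which are
    polynomially many because [k] is fixed. The number of coins consumed does not depend on their
    outcome, and a bad draw affects neither the running time nor the feasibility of what is printed:
    it can only lose covers. Since costs are logarithmic, the size of intermediate numbers must be
    controlled. Powers of X with polynomial exponents have polynomially many bits, and the
    Faddeev-LeVerrier recursion needs neither pivoting nor fractions; each of its n - 1 steps
    enlarges the entries by at most a fixed factor, [growth]. The cost of a run thus reduces to two
    bounds, one on the bits of every stored value and one on the rounds of every loop. *)

Lemma bitlen_le (z : int) (b : nat) :
  (0 < b)%N -> (bitlen z <= b)%N = (`|z| < 2 ^ b)%N.
Proof.
move=> b0; rewrite /bitlen; case: (posnP `|z|%N) => [->|z0].
  by rewrite trunc_log0 b0 expn_gt0.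
apply/idP/idP => h.
  by apply: leq_trans (trunc_log_ltn `|z| (isT : (1 < 2)%N)) _; rewrite leq_exp2l.
rewrite -(@ltn_exp2l 2) //; apply: leq_ltn_trans h.
by apply: trunc_logP.
Qed.

Lemma ltn_bitlen z : (`|z| < 2 ^ bitlen z)%N.
Proof. by rewrite -bitlen_le. Qed.

(** Measures values in words of [b] bits: if inputs and registers fit into one word, the value of
    [e] fits into [expr_size e] words. The estimate is crude on purpose, since it only has to be
    independent of the instance. *)
Fixpoint expr_size (e : expr) : nat :=
  match e with
  | Const z => bitlen z
  | Inp e1 | Reg e1 => (expr_size e1).+1
  | Add e1 e2 | Sub e1 e2 | Mul e1 e2 => (expr_size e1 + expr_size e2)%N
  | Div e1 e2 => (expr_size e1 + expr_size e2)%N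
  end.

Fixpoint expr_cost (e : expr) : nat :=
  (expr_size e +
   match e with
   | Const _ => 0
   | Inp e1 | Reg e1 => expr_cost e1
   | Add e1 e2 | Sub e1 e2 | Mul e1 e2 | Div e1 e2 =>
       expr_cost e1 + expr_cost e2
   end)%N.

Lemma expr_size_gt0 e : (0 < expr_size e)%N.
Proof. by elim: e => //= a ha b hb; rewrite addn_gt0 ha. Qed.

Lemma absz_divz_le (a b : int) : (`|(a %/ b)%Z| <= `|a|)%N.
Proof.
case: (b =P 0) => [->|/eqP b0]; first by rewrite divz0.
have := divz_eq a b; have := modz_ge0 a b0; have := ltz_mod a b0.
set u := (a %/ b)%Z; set v := (a %% b)%Z; nia.
Qed.

Definition mem_bounded (b : nat) (m : int -> int) :=
  forall a, (`|m a| < 2 ^ b)%N.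

Section ExprCost.
Variables (x : seq int) (b : nat).
Hypothesis b0 : (0 < b)%N.
Hypothesis x_bound : forall j, (`|nth 0%R x j| < 2 ^ b)%N.

Lemma value_bound m e :
  mem_bounded b m -> (`|value x m e| < 2 ^ (expr_size e * b))%N.
Proof.
move=> mb; have pos u : (0 < 2 ^ u)%N by rewrite expn_gt0.
have lift u : (2 ^ b <= 2 ^ (u.+1 * b))%N by rewrite leq_exp2l // leq_pmull.
(* Sizes may be added even for a sum, because u + v <= u v when u and v are at least 2. *)
have add2 e1 e2 a1 a2 : (0 < e1 -> 0 < e2 -> a1 < 2 ^ (e1 * b) ->
    a2 < 2 ^ (e2 * b) -> a1 + a2 < 2 ^ ((e1 + e2) * b))%N.
  move=> he1 he2 h1 h2; rewrite mulnDl expnD.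
  have : (1 < 2 ^ (e1 * b))%N by rewrite -{1}(expn0 2) ltn_exp2l // muln_gt0 he1.
  have : (1 < 2 ^ (e2 * b))%N by rewrite -{1}(expn0 2) ltn_exp2l // muln_gt0 he2.
  move: h1 h2; set u := (2 ^ _)%N; set v := (2 ^ _)%N; nia.
elim: e => //=.
- move=> z; apply: leq_trans (ltn_bitlen z) _.
  by rewrite leq_exp2l // leq_pmulr.
- move=> e _; apply: leq_trans (lift _); rewrite /inp_at.
  by case: (value x m e).
- by move=> e _; apply: leq_trans (lift _).
- move=> e1 h1 e2 h2; apply: leq_ltn_trans (add2 _ _ _ _ _ _ h1 h2);
    rewrite ?expr_size_gt0 //; lia.
- move=> e1 h1 e2 h2; apply: leq_ltn_trans (add2 _ _ _ _ _ _ h1 h2);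
    rewrite ?expr_size_gt0 //; lia.
- move=> e1 h1 e2 h2; rewrite abszM mulnDl expnD; exact: ltn_mul.
- move=> e1 h1 e2 h2; apply: leq_ltn_trans (absz_divz_le _ _) _.
  by apply: leq_trans h1 _; rewrite leq_exp2l // leq_mul2r leq_addr orbT.
Qed.

Lemma ecost_le m e : mem_bounded b m -> (ecost x m e <= expr_cost e * b)%N.
Proof.
move=> mb; have vb e1 : (bitlen (value x m e1) <= expr_size e1 * b)%N.
  by rewrite bitlen_le ?muln_gt0 ?expr_size_gt0 //; apply: value_bound.
elim: e => /= [z|e1 h1|e1 h1|e1 h1 e2 h2|e1 h1 e2 h2|e1 h1 e2 h2|e1 h1 e2 h2];
  rewrite mulnDl ?addn0; try (apply: leq_trans (vb (Const z)) _ => //; lia);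
  rewrite ?mulnDl leq_add ?leq_add //.
- exact: (vb (Inp e1)).
- exact: (vb (Reg e1)).
- by rewrite -mulnDl; apply: (vb (Add e1 e2)).
- by rewrite -mulnDl; apply: (vb (Sub e1 e2)).
- by rewrite -mulnDl; apply: (vb (Mul e1 e2)).
- by rewrite -mulnDl; apply: (vb (Div e1 e2)).
Qed.
End ExprCost.

(** Cost in units of [b], with [N] bounding the rounds of every loop. For a fixed program this is a
    polynomial in [N], which is all that the final time bound needs. *)
Fixpoint cmd_cost (N : nat) (c : cmd) : nat :=
  match c with
  | Skip => 1
  | Store a e => 1 + expr_cost a + expr_cost e
  | Flip a => 1 + expr_cost a
  | Write e => 1 + expr_cost e
  | Seq c1 c2 => cmd_cost N c1 + cmd_cost N c2
  | If e c1 c2 => 1 + expr_cost e + cmd_cost N c1 + cmd_cost N c2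
  | While e c => N.+1 * (1 + expr_cost e + cmd_cost N c)
  end%N.

Section WP.
Variables (x : seq int) (b N : nat).

(** The body enters as a predicate transformer, which lets [wpre] recurse structurally through
    [While]. The index [j] is the exact number of rounds, so termination is part of the
    assertion. *)
Fixpoint loop (e : expr) (body : (state -> Prop) -> state -> Prop)
    (Q : state -> Prop) (j : nat) (s : state) : Prop :=
  if j is j'.+1 then 0 < value x (regs s) e /\ body (loop e body Q j') s
  else value x (regs s) e <= 0 /\ Q s.

(* Besides partial correctness, wpre asserts everything the cost bound needs:
   stored values have at most b bits and no loop makes more than N rounds. *)
Fixpoint wpre (c : cmd) (Q : state -> Prop) (s : state) : Prop :=
  let v := value x (regs s) in
  match c with
  | Skip => Q s
  | Store a e => (`|v e| < 2 ^ b)%N /\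
      Q (State (upd (regs s) (v a) (v e)) (coins s) (output s))
  | Flip a => if coins s is d :: r then
      Q (State (upd (regs s) (v a) (d : nat)%:Z) r (output s)) else False
  | Write e => Q (State (regs s) (coins s) (rcons (output s) (v e)))
  | Seq c1 c2 => wpre c1 (wpre c2 Q) s
  | If e c1 c2 => if 0 < v e then wpre c1 Q s else wpre c2 Q s
  | While e c => exists j, (j <= N)%N /\ loop e (wpre c) Q j s
  end.

Hypothesis b0 : (0 < b)%N.
Hypothesis x_bound : forall j, (`|nth 0%R x j| < 2 ^ b)%N.

Lemma wp_exec c Q s : mem_bounded b (regs s) -> wpre c Q s ->
  exists t s', [/\ exec x c s t s', (t <= cmd_cost N c * b)%N,
    mem_bounded b (regs s') & Q s'].
Proof.
have upd_b m a z : mem_bounded b m -> (`|z| < 2 ^ b)%N -> mem_bounded b (upd m a z).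
  by move=> mb hz a'; rewrite /upd; case: eqP.
have ec := ecost_le b0 x_bound.
elim: c Q s => [|a e|a|e|c1 IH1 c2 IH2|e c1 IH1 c2 IH2|e c IH] Q [m r o] /= mb.
- by move=> q; exists 1%N, (State m r o); split=> //; [constructor|lia].
- move=> [hv q]; exists (1 + ecost x m a + ecost x m e)%N,
    (State (upd m (value x m a) (value x m e)) r o).
  split=> //; [constructor| |exact: upd_b].
  by have := ec _ a mb; have := ec _ e mb; nia.
- case: r => // d r q; exists (1 + ecost x m a)%N, (State (upd m (value x m a) (d : nat)%:Z) r o).
  split=> //; [constructor| |apply: upd_b => //=].
    by have := ec _ a mb; nia.
  by case: d {q} => /=; rewrite ?expn_gt0 // -{1}(expn0 2) ltn_exp2l.
- move=> q; exists (1 + ecost x m e)%N, (State m r (rcons o (value x m e))).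
  split=> //; [constructor|].
  by have := ec _ e mb; nia.
- move=> /(IH1 _ (State m r o) mb) [t1 [s1 [e1 le1 mb1 /(IH2 _ _ mb1) [t2 [s2 [e2 le2 mb2 q]]]]]].
  by exists (t1 + t2)%N, s2; split=> //; [exact: ExecSeq e1 e2|nia].
- have hec := ec _ e mb.
  case: ltP => he.
    move=> /(IH1 _ (State m r o) mb) [t1 [s1 [e1 le1 mb1 q]]].
    exists (1 + ecost x m e + t1)%N, s1; split=> //; [exact: ExecIfTrue|nia].
  move=> /(IH2 _ (State m r o) mb) [t1 [s1 [e1 le1 mb1 q]]].
  exists (1 + ecost x m e + t1)%N, s1; split=> //; [exact: ExecIfFalse|nia].
- move=> [j [jN lj]].
  (* The induction needs the actual number [j] of remaining rounds in the bound; [N] only majorises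
     it. *)
  suff: exists t s', [/\ exec x (While e c) (State m r o) t s',
      (t <= j.+1 * (1 + expr_cost e + cmd_cost N c) * b)%N, mem_bounded b (regs s') & Q s'].
    move=> [t [s' [ex lt mb' q]]]; exists t, s'; split=> //; apply: leq_trans lt _.
    by rewrite leq_mul2r leq_mul2r ltnS jN !orbT.
  have {}mb : mem_bounded b (regs (State m r o)) by [].
  move: (State m r o) mb lj => {m r o} s; elim: j {jN} s => [|j IHj] s mb /= [he].
    move=> q; exists (1 + ecost x (regs s) e)%N, s; split=> //; first exact: ExecWhileFalse.
    by have := ec _ e mb; nia.
  move=> /(IH _ _ mb) [t1 [s1 [e1 le1 mb1 /(IHj _ mb1) [t2 [s2 [e2 le2 mb2 q]]]]]].
  exists (1 + ecost x (regs s) e + t1 + t2)%N, s2; split=> //; first exact: ExecWhileTrue e1 e2.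
  have := ec _ e mb; rewrite mulSn; nia.
Qed.

Lemma wp_weaken c (Q1 Q2 : state -> Prop) s :
  (forall s', Q1 s' -> Q2 s') -> wpre c Q1 s -> wpre c Q2 s.
Proof.
elim: c Q1 Q2 s => [|a e|a|e|c1 IH1 c2 IH2|e c1 IH1 c2 IH2|e c IH] Q1 Q2 s h /=.
- exact: h.
- by move=> [? /h].
- by case: (coins s) => // d r /h.
- exact: h.
- by apply: IH1 => s'; apply: IH2.
- by case: ifP => _; [apply: IH1|apply: IH2].
- move=> [j [jN l]]; exists j; split=> //.
  elim: j {jN} s l => [|j IHj] s /= [he l]; split=> //; first exact: h.
  by move: l; apply: IH.
Qed.

End WP.

(** * Cofactors by the Faddeev-LeVerrier recursion, and packed polynomials *)

Lemma deriv_prod (R : comNzRingType) (I : finType) (F : I -> {poly R}) :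
  (\prod_i F i)^`() = \sum_i (F i)^`() * \prod_(j | i != j) F j.
Proof.
suff H (s : seq I) : uniq s -> (\prod_(i <- s) F i)^`() =
    \sum_(i <- s) (F i)^`() * \prod_(j <- s | i != j) F j.
  by rewrite H ?index_enum_uniq.
elim: s => [_|a s IH /= /andP [ha us]]; first by rewrite !big_nil derivC.
rewrite !big_cons derivM (IH us) eqxx /=; congr (_ * _ + _).
  rewrite [RHS]big_seq_cond [LHS]big_seq; apply: eq_bigl => j.
  by case: eqP => [<-|]; rewrite ?(negPf ha) ?andbT.
rewrite big_distrr /= big_seq [RHS]big_seq; apply: eq_bigr => i hi.
rewrite big_cons; case: eqP => [e|_]; last by rewrite mulrCA.
by rewrite -e hi in ha.
Qed.

(** Jacobi's formula for X - A. In the Leibniz expansion, differentiating the factor of row i leaves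
    1 if the permutation fixes i and 0 otherwise; the remaining factors form the cofactor at (i,
    i). *)
Lemma deriv_char_poly (R : comNzRingType) n (A : 'M[R]_n) :
  (char_poly A)^`() = \tr (\adj (char_poly_mx A)).
Proof.
rewrite /char_poly /determinant raddf_sum /=.
under eq_bigr => s _.
  rewrite -signr_odd mulr_sign.
  have -> (b : bool) (p : {poly R}) : (if b then - p else p)^`() = (-1) ^+ b * p^`().
    by rewrite mulr_sign; case: b; rewrite ?derivN.
  rewrite signr_odd deriv_prod mulr_sumr.
  over.
rewrite exchange_big /=; apply: eq_bigr => i _.
rewrite mxE expand_cofactor [RHS]big_mkcond /=; apply: eq_bigr => s _.
rewrite !mxE [s i == i]eq_sym; case: eqP => _.
  by rewrite mulr1n derivB derivX derivC subr0 mul1r.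
by rewrite mulr0n derivB !derivC subrr mul0r mulr0.
Qed.

Section FaddeevLeVerrier.
Variables (n : nat) (A : 'M[int]_n).

(* The division is exact for j < n, by tr (adj (X - A)) = (det (X - A))'. *)
Fixpoint faddeev (j : nat) : 'M[int]_n :=
  if j is j'.+1 then
    let T := A *m faddeev j' in T - (\tr T %/ j%:Z)%Z%:M
  else 1%:M.

(** The matrix coefficient of X^i when adj (X - A) is read as a polynomial with matrix
    coefficients. *)
Let adjc i : 'M[int]_n := map_mx (coefp i) (\adj (char_poly_mx A)).

(** Compare the coefficients of X^(i+1) in (X - A) adj (X - A) = det (X - A). *)
Let adjc_rec i : adjc i = A *m adjc i.+1 + ((char_poly A)`_i.+1)%:M.
Proof.
have := mul_mx_adj (char_poly_mx A).
rewrite {1}/char_poly_mx mulmxBl mul_scalar_mx => /matrixP E.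
apply/matrixP => u v; have := E u v; rewrite !mxE => /(congr1 (coefp i.+1)) /=.
rewrite coefB coefXM /= coefMn coef_sum => <-.
rewrite addrC; set s1 := \sum_(_ < _) _; set s2 := \sum_(_ < _) _.
suff -> : s1 = s2 by rewrite subrK.
by apply: eq_bigr => w _; rewrite !mxE /= coefCM.
Qed.

(** The coefficients vanish beyond some degree d, and the recurrence carries this down to index n,
    since the characteristic polynomial has no coefficient above X^n. *)
Let adjc_big i : (n <= i)%N -> adjc i = 0.
Proof.
pose d := \max_u \max_v size (\adj (char_poly_mx A) u v).
suff H m : forall i, (n <= i)%N -> (d <= i + m)%N -> adjc i = 0.
  by move=> hi; apply: (H d) => //; rewrite leq_addl.
elim: m => [|m IH] {}i hi hd.
  apply/matrixP => u v; rewrite [LHS]mxE [RHS]mxE /=; apply: nth_default.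
  apply: leq_trans (leq_trans _ hd) _; last by rewrite addn0.
  by apply: leq_trans (leq_bigmax u); apply: (leq_trans _ (leq_bigmax v)).
rewrite adjc_rec IH ?mulmx0 ?add0r //; last 2 first.
- exact: leq_trans hi _.
- by rewrite addSnnS.
by rewrite nth_default ?size_char_poly ?ltnS // raddf0.
Qed.

Let tr_adjc i : \tr (adjc i) = (char_poly A)`_i.+1 *+ i.+1.
Proof.
rewrite -coef_deriv deriv_char_poly /mxtrace coef_sum.
by apply: eq_bigr => u _; rewrite !mxE.
Qed.

(** Let c be the coefficient of X^(i+1) in the characteristic polynomial and T the product in the
    next step, where n = (i+1) + (j+1). Taking traces in [adjc_rec] and using [tr_adjc] gives (i+1)
    c = tr T + n c. Hence tr T = -(j+1) c, and the quotient subtracted by the recursion is exactly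
    -c. *)
Let faddeevE j : (j < n)%N -> faddeev j = adjc (n.-1 - j).
Proof.
elim: j => [n0|j IH jn] /=.
  rewrite subn0 adjc_rec (prednK n0) adjc_big // mulmx0 add0r.
  by have /monicP := char_poly_monic A; rewrite lead_coefE size_char_poly => ->.
rewrite (IH (ltnW jn)) [RHS]adjc_rec; have -> : (n.-1 - j.+1).+1 = (n.-1 - j)%N by lia.
congr (_ + _); rewrite -raddfN /=; congr (_%:M).
set i := (n.-1 - j.+1)%N; have ei : (n.-1 - j = i.+1)%N by lia.
rewrite ei; have := tr_adjc i; rewrite adjc_rec mxtraceD mxtrace_scalar.
move=> /(canRL (addrK _)) ->.
have -> : (char_poly A)`_i.+1 *+ i.+1 - (char_poly A)`_i.+1 *+ n =
   - (char_poly A)`_i.+1 * j.+1%:Z.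
  move: (char_poly A)`_i.+1 => c; have -> : n = (i.+1 + j.+1)%N by lia.
  by rewrite mulrnDr opprD addrA subrr add0r mulNr -natz mulr_natr.
by rewrite mulzK // opprK.
Qed.

Lemma faddeev_adj : faddeev n.-1 = \adj (- A).
Proof.
case: (posnP n) => [n0|n0]; first by apply/matrixP => u; have := leq_trans (ltn_ord u) (eq_leq n0).
rewrite faddeevE ?prednK // subnn /adjc.
have -> : - A = map_mx (horner_eval 0) (char_poly_mx A).
  by apply/matrixP => u v; rewrite !mxE /horner_eval hornerD hornerMn hornerX hornerN hornerC mul0rn add0r.
rewrite -map_mx_adj; apply/matrixP => u v; rewrite !mxE /=.
by rewrite /horner_eval horner_coef0.
Qed.

(* The summand of sigma is, up to a sign, the monomial of sigma in det A. *)
Lemma mul_faddeev u v :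
  exists b : 'S_n -> bool, A u v * faddeev n.-1 v u =
    \sum_(s : 'S_n | s u == v) (-1) ^+ b s * \prod_i A i (s i).
Proof.
(* The recursion ends in the adjugate of -A, so the n - 1 negated entries in each summand of a
   cofactor contribute an extra sign (-1)^(n-1). *)
exists (fun s => odd_perm s (+) odd n.-1); rewrite faddeev_adj mxE expand_cofactor mulr_sumr.
apply: eq_bigr => s /eqP sv; rewrite [in RHS](bigD1 u) //= sv mulrCA [RHS]mulrCA.
rewrite signr_addb mulrCA -mulrA; congr (_ * (_ * _)).
under eq_bigr => i _ do rewrite mxE.
rewrite prodrN signr_odd; congr (_ ^+ _ * _); last by apply: eq_bigl => i; rewrite eq_sym.
by have := cardC1 u; rewrite card_ord => <-; apply: eq_card => i; rewrite !inE eq_sym.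
Qed.

End FaddeevLeVerrier.

(* The coefficient c of X^s in the polynomial packed into y is, modulo X, the
   integer nearest to y / X^s; unit_flag tells whether it is nonzero. *)
Definition unit_flag (X P y : int) : int :=
  let q := ((y + y + P) %/ (P + P))%Z in
  ((q - X * (q %/ X)%Z + (X - 1)) %/ X)%Z.

(** Rounding to the nearest multiple of P, rather than down, absorbs lower terms [l] of either sign.
    The last quotient is the ceiling of d / X for a remainder 0 <= d < X, thus 1 unless d = 0. *)
Lemma unit_flagE (X P Y c l : int) :
  0 < P -> `|c| < X -> `|l + l| < P ->
  unit_flag X P (X * P * Y + c * P + l) = (c != 0 :> int : nat)%:Z.
Proof.
move=> P0 cX lP; rewrite /unit_flag.
have X0 : 0 < X by apply: le_lt_trans cX.
have -> : (X * P * Y + c * P + l + (X * P * Y + c * P + l) + P) =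
   (X * Y + c) * (P + P) + (l + l + P) by ring.
rewrite divzMDl; last by apply/eqP; lia.
have -> : ((l + l + P) %/ (P + P))%Z = 0.
  by apply: divz_small; apply/andP; split; lia.
rewrite addr0.
(* A negative coefficient appears as the digit c + X, with a borrow from the higher terms; it is
   still nonzero. *)
have [q [d [hq hd]]] : exists q d, X * Y + c = X * q + d /\
    [/\ 0 <= d, d < X & (d == 0) = (c == 0)].
  case: (ltP c 0) => c0.
    exists (Y - 1), (c + X); split; first ring.
    by split; lia.
  by exists Y, c; split=> //; split=> //; lia.
rewrite hq; case: hd => d0 dX <-.
have -> : ((X * q + d) %/ X)%Z = q.
  by rewrite mulrC divzMDl ?divz_small ?addr0 ?d0 //=; [lia|apply/eqP; lia].
have -> : X * q + d - X * q + (X - 1) = d + (X - 1) by ring.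
case: eqP => [->|dn]; first by rewrite add0r divz_small //; apply/andP; split; lia.
have -> : d + (X - 1) = 1 * X + (d - 1) by ring.
by rewrite divzMDl ?divz_small ?addr0 //=; [apply/andP; split; lia|apply/eqP; lia].
Qed.

(** Covers an arbitrary [y], so that the flags are bits even for a draw that isolates nothing. *)
Lemma unit_flag01 X P y : 0 < X ->
  unit_flag X P y = 0 \/ unit_flag X P y = 1.
Proof.
rewrite /unit_flag; set q := (_ %/ (P + P))%Z => X0.
have Xn : X != 0 by apply/eqP; lia.
have := divz_eq q X; have := modz_ge0 q Xn; have := ltz_pmod q X0.
set d := (q %% X)%Z; set e := (q %/ X)%Z => h1 h2 ->.
have -> : e * X + d - X * e + (X - 1) = d + (X - 1) by ring.
case: (d =P 0) => [->|dn]; first by left; rewrite add0r divz_small //; apply/andP; split; lia.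
have -> : d + (X - 1) = 1 * X + (d - 1) by ring.
by right; rewrite divzMDl ?divz_small ?addr0 //=; apply/andP; split; lia.
Qed.

Lemma unit_flag0 X P : 0 < X -> 0 < P -> unit_flag X P 0 = 0.
Proof.
move=> X0 P0; have := @unit_flagE X P 0 0 0 P0.
by rewrite mulr0 mul0r !addr0 normr0 => ->.
Qed.

(** Terms with exponent above s are multiples of X^(s+1). Those below s total at most #|I| X^(s-1),
    which is less than half of X^s because X exceeds 2 #|I|; this is the origin of the factor 2 in
    [packing]. *)
Lemma unit_flag_sum (I : finType) (D : pred I) (b : I -> bool) (e : I -> nat)
    (X : int) (s : nat) :
  (#|I|.*2)%:Z < X ->
  unit_flag X (X ^+ s) (\sum_(i | D i) (-1) ^+ b i * X ^+ e i) =
  (\sum_(i | D i && (e i == s)) (-1) ^+ b i != 0 :> int : nat)%:Z.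
Proof.
move=> hX; have X0 : 0 < X by lia.
have sgn_le (C : pred I) : `|\sum_(i | C i) (-1) ^+ b i : int| <= #|I|%:Z.
  apply: le_trans (ler_norm_sum _ _ _) _.
  under eq_bigr => i _ do rewrite normrX normrN1 expr1n.
  by rewrite sumr_const natz lez_nat max_card.
rewrite (bigID (fun i => e i == s)) /= [X in _ + X](bigID (fun i => (s < e i)%N)) /=.
set c := \sum_(i | _) (-1) ^+ b i.
have -> : \sum_(i | D i && (e i == s)) (-1) ^+ b i * X ^+ e i = c * X ^+ s.
  by rewrite mulr_suml; apply: eq_bigr => i /andP [_ /eqP ->].
have [Y ->] : exists Y, \sum_(i | D i && (e i != s) && (s < e i)%N)
    (-1) ^+ b i * X ^+ e i = X * X ^+ s * Y.
  exists (\sum_(i | D i && (e i != s) && (s < e i)%N) (-1) ^+ b i * X ^+ (e i - s.+1)).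
  rewrite mulr_sumr; apply: eq_bigr => i /andP [_ h].
  by rewrite -exprS mulrCA -exprD subnKC.
set l := \sum_(i | _ && ~~ _) _.
(* Multiplying by X avoids the exponent s - 1, which would be truncated for s = 0. *)
have hl : `|l| * X <= #|I|%:Z * X ^+ s.
  apply: le_trans (ler_wpM2r (ltW X0) (ler_norm_sum _ _ _)) _; rewrite mulr_suml.
  apply: (@le_trans _ _ (\sum_(i | D i && (e i != s) && ~~ (s < e i)%N) X ^+ s)).
    apply: ler_sum => i /andP [/andP [_ h1] h2].
    rewrite normrM !normrX normrN1 expr1n mul1r gtr0_norm // -exprSr.
    apply: ler_weXn2l; first lia.
    by rewrite ltn_neqAle h1 leqNgt.
  rewrite sumr_const -mulr_natl; apply: ler_wpM2r; first exact: ltW (exprn_gt0 _ _).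
  by rewrite natz lez_nat; apply: max_card.
have Ps : 0 < X ^+ s by rewrite exprn_gt0.
have -> : c * X ^+ s + (X * X ^+ s * Y + l) = X * X ^+ s * Y + c * X ^+ s + l by ring.
apply: unit_flagE => //.
  by have := sgn_le [pred i | D i && (e i == s)]; rewrite -/c; lia.
rewrite -(ltr_pM2r X0); apply: (@le_lt_trans _ _ (#|I|.*2%:Z * X ^+ s)).
  rewrite -mulr2n normrMn -muln2 PoszM; lia.
by rewrite mulrC ltr_pM2l.
Qed.

(** * The isolation lemma *)

Section Isolation.
Variables (Omega E K : finType) (val : K -> nat) (label : Omega -> E -> K).
Variable relabel : Omega -> E -> K -> Omega.
Hypothesis val_inj : injective val.
Hypothesis label_relabel : forall o e b e',
  label (relabel o e b) e' = if e' == e then b else label o e'.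
Hypothesis relabel_relabel : forall o e b b',
  relabel (relabel o e b) e b' = relabel o e b'.
Hypothesis relabel_label : forall o e, relabel o e (label o e) = o.

Variable F : {set {set E}}.

Definition label_weight (o : Omega) (S : {set E}) : nat :=
  (\sum_(e in S) val (label o e))%N.

Definition minimal (o : Omega) (S : {set E}) : bool :=
  (S \in F) && [forall S' in F, (label_weight o S <= label_weight o S')%N].

Definition isolated (o : Omega) : bool :=
  [forall S, forall S', minimal o S && minimal o S' ==> (S == S')].

Let tied e : {set Omega} :=
  [set o | [exists S, exists S',
    [&& minimal o S, minimal o S', e \in S & e \notin S']]].

(* Raising the label of e alone makes the minimal set avoiding e strictly
   better than every set containing e. *)
Let tied_label e o o' : o \in tied e -> o' \in tied e ->
  (forall e', e' != e -> label o e' = label o' e') ->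
  (val (label o' e) <= val (label o e))%N.
Proof.
rewrite !inE => /existsP [S1 /existsP [S2 /and4P]].
move=> [/andP [F1 /forall_inP m1] /andP [F2 /forall_inP m2] e1 e2].
move=> /existsP [S1' /existsP [S2' /and4P]].
move=> [/andP [F1' /forall_inP m1'] /andP [F2' /forall_inP m2'] e1' e2'].
move=> ag; rewrite leqNgt; apply/negP => lt.
have agS (S : {set E}) : e \notin S -> label_weight o S = label_weight o' S.
  move=> he; apply: eq_bigr => f hf; rewrite ag //; apply: contraNneq he => <- //.
have ltS (S : {set E}) : e \in S -> (label_weight o S < label_weight o' S)%N.
  move=> he; rewrite /label_weight (bigD1 e he) [X in (_ < X)%N](bigD1 e he) /= -addSn leq_add //.
  by apply: eq_leq; apply: eq_bigr => f /andP [_ hf]; rewrite ag.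
have := ltS _ e1'; have := agS _ e2.
have := m1 _ F1'; have := m2 _ F1; have := m1' _ F2.
have := m2' _ F1'; have := m1' _ F2'; have := m1 _ F2; lia.
Qed.

(** By [tied_label] used in both directions, the other labels determine the label of e within
    [tied e]. Overwriting that label by an arbitrary b is therefore injective on pairs of a tied
    draw and b. *)
Let card_tied e : (#|tied e| * #|K| <= #|Omega|)%N.
Proof.
rewrite -cardsT -cardsX.
pose f (p : Omega * K) := relabel p.1 e p.2.
rewrite -(@card_in_imset _ _ f); first exact: max_card.
move=> [o b] [o' b']; rewrite !in_setX !in_setT !andbT /f /= => ho ho' eqf.
have eb : b = b'.
  by have := label_relabel o e b e; rewrite eqf label_relabel eqxx => ->.
have ag e' : e' != e -> label o e' = label o' e'.
  move=> ne; have := label_relabel o e b e'; rewrite eqf label_relabel (negPf ne).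
  by move=> ->.
have el : label o e = label o' e.
  apply: val_inj; apply/eqP; rewrite eqn_leq; apply/andP; split; last exact: tied_label ho ho' ag.
  by apply: tied_label ho' ho _ => e' /ag.
by rewrite -eb -(relabel_label o e) -(relabel_relabel o e b) eqf eb relabel_relabel el relabel_label.
Qed.

(** Two distinct minimal sets disagree on some element e, which makes the draw tied at e; then sum
    over all e. *)
Lemma card_not_isolated :
  (#|[set o | ~~ isolated o]| * #|K| <= #|E| * #|Omega|)%N.
Proof.
have sub : [set o | ~~ isolated o] \subset \bigcup_e tied e.
  apply/subsetP => o; rewrite inE negb_forall => /existsP [S].
  rewrite negb_forall => /existsP [S']; rewrite negb_imply => /andP [/andP [m m'] ne].
  have [e he] : exists e, (e \in S) != (e \in S').
    apply/existsP; apply: contraR ne; rewrite negb_exists => /forallP h.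
    by apply/eqP/setP => e; have := h e; rewrite negbK => /eqP.
  apply/bigcupP; exists e => //; rewrite inE.
  case eS : (e \in S) he => he.
    by apply/existsP; exists S; apply/existsP; exists S'; rewrite m m' eS; case: (e \in S') he.
  by apply/existsP; exists S'; apply/existsP; exists S; rewrite m m' eS; case: (e \in S') he.
apply: leq_trans (leq_mul (subset_leq_card sub) (leqnn _)) _.
apply: leq_trans (leq_mul (_ : _ <= \sum_e #|tied e|)%N (leqnn _)) _.
  elim/big_ind2: _ => [|A a B b hA hB|//]; first by rewrite cards0.
  by apply: leq_trans (leq_add hA hB); rewrite cardsU leq_subr.
rewrite big_distrl /= -sum_nat_const.
by apply: leq_sum => e _; exact: card_tied.
Qed.
End Isolation.

(** * Labels as blocks of random bits *)

Definition bin_val (l : seq bool) : nat := foldl (fun (a : nat) (d : bool) => a + a + d)%N 0%N l.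

Lemma bin_val_rcons l d : bin_val (rcons l d) = (bin_val l + bin_val l + d)%N.
Proof. by rewrite /bin_val foldl_rcons. Qed.

Lemma bin_val_inj l l' : size l = size l' -> bin_val l = bin_val l' -> l = l'.
Proof.
elim/last_ind: l l' => [|l d IH] l'; first by case: l'.
case/lastP: l' => [|l' d']; rewrite !size_rcons // !bin_val_rcons => - [hs] h.
by have [-> ->] : l = l' /\ d = d' by split; [apply: IH => //|]; case: d d' h => [] []; lia.
Qed.

Lemma bin_val_lt l : (bin_val l < 2 ^ size l)%N.
Proof.
elim/last_ind: l => // l d IH; rewrite size_rcons bin_val_rcons expnS; case: d; lia.
Qed.

Definition block (rho : nat) (r : seq bool) (e : nat) : seq bool :=
  mkseq (fun j => nth false r (e * rho + j)) rho.

(** The list [block] is what the program reads; this typed copy takes values in a finite type, as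
    the isolation lemma demands. *)
Definition block_tuple (t m rho : nat) (r : t.-tuple bool) (e : 'I_m) :
    rho.-tuple bool := [tuple nth false r (e * rho + j) | j < rho].

Lemma block_tupleE t m rho (r : t.-tuple bool) (e : 'I_m) :
  block rho r e = block_tuple rho r e.
Proof. by rewrite /= /block /mkseq -val_enum_ord -map_comp. Qed.

Section Blocks.
Variables (t m rho : nat).
Hypothesis mt : (m * rho <= t)%N.

Let lab : t.-tuple bool -> 'I_m -> rho.-tuple bool := @block_tuple t m rho.

Let relab (r : t.-tuple bool) (e : 'I_m) (b : rho.-tuple bool) : t.-tuple bool :=
  [tuple if (e * rho <= i < e * rho + rho)%N then nth false b (i - e * rho)
         else nth false r i | i < t].

Let nth_relab r e b i : (i < t)%N -> nth false (relab r e b) i =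
  if (e * rho <= i < e * rho + rho)%N then nth false b (i - e * rho)
  else nth false r i.
Proof.
by move=> h; rewrite -[i]/(nat_of_ord (Ordinal h)) -tnth_nth tnth_mktuple.
Qed.

Let nth_lab r e i : (i < rho)%N -> nth false (lab r e) i = nth false r (e * rho + i).
Proof.
by move=> h; rewrite -[i]/(nat_of_ord (Ordinal h)) -tnth_nth tnth_mktuple.
Qed.

Let tupleP' s (a b : s.-tuple bool) :
  (forall i, (i < s)%N -> nth false a i = nth false b i) -> a = b.
Proof. by move=> h; apply: eq_from_tnth => i; rewrite !(tnth_nth false) h. Qed.

Lemma card_not_isolated_blocks (F : {set {set 'I_m}}) :
  (#|[set r : t.-tuple bool |
       ~~ isolated (fun b : rho.-tuple bool => bin_val b) (@block_tuple t m rho) F r]| * 2 ^ rho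
    <= m * 2 ^ t)%N.
Proof.
have := @card_not_isolated (t.-tuple bool) 'I_m (rho.-tuple bool)
  (fun b => bin_val b) lab relab _ _ _ _ F.
rewrite !card_tuple card_bool card_ord; apply.
- by move=> b b' /bin_val_inj h; apply/val_inj/h; rewrite !size_tuple.
- move=> r e b e'; apply: tupleP' => j hj; have := ltn_ord e'.
  rewrite nth_lab // => he'; rewrite nth_relab; last by apply: leq_trans mt; nia.
  case: eqP => [->|ne]; first by rewrite leq_addr ltn_add2l hj addKn.
  rewrite nth_lab //; case: ifP => // /andP [h1 h2].
  have {}ne : nat_of_ord e' <> nat_of_ord e by move=> /val_inj.
  by exfalso; apply: ne; nia.
- move=> r e b b'; apply: tupleP' => j hj; rewrite !nth_relab //; case: ifP => [|->] //.
- move=> r e; apply: tupleP' => j hj; rewrite nth_relab //; case: ifP => // /andP [h1 h2].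
  by rewrite nth_lab ?subnKC //; lia.
Qed.
End Blocks.

(** * Cycle covers as permutations *)

Definition perm_edges (V : finType) (s : {perm V}) : {set V * V} :=
  [set (v, s v) | v : V].

Lemma mem_perm_edges (V : finType) (s : {perm V}) u v :
  ((u, v) \in perm_edges s) = (s u == v).
Proof.
apply/imsetP/eqP => [[w _ [-> ->]] //|<-]; by exists u.
Qed.

Lemma big_perm_edges (V : finType) (s : {perm V}) (f : V * V -> nat) :
  (\sum_(e in perm_edges s) f e = \sum_u f (u, s u))%N.
Proof. by rewrite big_imset //= => u v _ _ []. Qed.

Lemma mem_bigcup_cycles (V : finType) (cs : seq (seq V)) u v :
  ((u, v) \in \bigcup_(c <- cs) cycle_edges c) =
  has (fun c => (u \in c) && (next c u == v)) cs.
Proof.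
elim: cs => [|c cs IH] /=; first by rewrite big_nil inE.
rewrite big_cons inE IH; congr (_ || _); rewrite inE.
apply/mapP/andP => [[w hw [-> ->]] //|[hu /eqP <-]]; by exists u.
Qed.

(** Every vertex lies on exactly one listed cycle, and the permutation moves it to its successor
    there. If two vertices have the same successor, that vertex puts them on one cycle, where [prev]
    undoes [next]. *)
Lemma cycle_cover_perm (V : finType) (E C : {set V * V}) :
  is_cycle_cover E C -> exists2 s : {perm V}, C = perm_edges s & C \subset E.
Proof.
case=> sub [cs [/allP good cnt defC]].
pose cy v := nth [::] cs (find (fun c => v \in c) cs).
have hs v : has (fun c : seq V => v \in c) cs by rewrite has_count cnt.
have cyin v : cy v \in cs by rewrite mem_nth // -has_find.
have vcy v : v \in cy v by exact: (nth_find [::] (hs v)).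
have cyE v c : c \in cs -> v \in c -> c = cy v.
  move=> hc vc; have := cnt v; rewrite -size_filter.
  case Ef : (filter _ _) => [|c0 [|? ?]] // _.
  have in0 c' : c' \in cs -> v \in c' -> c' = c0.
    move=> h1 h2; apply/eqP; rewrite -mem_seq1 -Ef mem_filter h2; exact: h1.
  by rewrite (in0 _ hc vc) -(in0 _ (cyin v) (vcy v)).
pose f v := next (cy v) v.
have f_inj : injective f.
  move=> v w e.
  have h1 : f v \in cy v by rewrite /f mem_next.
  have h2 : f v \in cy w by rewrite e /f mem_next.
  have ec : cy v = cy w by rewrite (cyE _ _ (cyin v) h1) -(cyE _ _ (cyin w) h2).
  have /andP [_ uc] := good _ (cyin w).
  by apply: (can_inj (prev_next uc)); rewrite -{1}ec.
exists (perm f_inj) => //; rewrite defC; apply/setP => - [u v].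
rewrite mem_bigcup_cycles mem_perm_edges permE.
apply/hasP/eqP => [[c hc /andP [uc /eqP <-]]|<-]; first by rewrite /f -(cyE _ _ hc uc).
by exists (cy u) => //; rewrite vcy eqxx.
Qed.

(** The cycles are the orbits of [s], one for each canonical root; a fixed point gives a loop, which
    counts as a cycle. *)
Lemma perm_cycle_cover (V : finType) (E : {set V * V}) (s : {perm V}) :
  perm_edges s \subset E -> is_cycle_cover E (perm_edges s).
Proof.
move=> sub; split=> //.
pose f : V -> V := s; have sI : injective f := @perm_inj _ s.
exists [seq fingraph.orbit f x | x <- enum (froots f)]; split.
- apply/allP => _ /mapP [x _ ->]; rewrite orbit_uniq andbT.
  by rewrite -size_eq0 size_orbit -lt0n fingraph.order_gt0.
- move=> v; rewrite count_map.
  (* The orbit of a root contains v exactly when that root is the root of v. *)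
  rewrite -[RHS](_ : count_mem (froot f v) (enum (froots f)) = _); last first.
    rewrite count_uniq_mem ?enum_uniq // mem_enum inE /= /roots /=.
    by rewrite (root_root (fconnect_sym sI)) eqxx.
  apply: eq_in_count => x; rewrite mem_enum => /eqP rx /=.
  by rewrite -fconnect_orbit -(root_connect (fconnect_sym sI)) rx.
- apply/setP => - [u v]; rewrite mem_bigcup_cycles mem_perm_edges has_map.
  have nx x : u \in fingraph.orbit f x -> next (fingraph.orbit f x) u = s u.
    by move=> h; have /eqP := next_cycle (cycle_orbit sI x) h.
  apply/eqP/hasP => [<-|[x _ /= /andP [hu /eqP <-]]]; last by rewrite nx.
  exists (froot f u).
    by rewrite mem_enum inE /= /roots (root_root (fconnect_sym sI)).
  have hu : u \in fingraph.orbit f (froot f u).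
    by rewrite -fconnect_orbit (fconnect_sym sI); apply: connect_root.
  by rewrite /= hu nx ?eqxx.
Qed.

(** * Loops and frames *)

Notation memory := (int -> int).

Lemma upd_nn m i z j : upd m (Negz i) z (Negz j) = if j == i then z else m (Negz j).
Proof. by rewrite /upd; do 2 case: eqP => //; [move=> ne [/ne]|move=> -> /(_ erefl)]. Qed.

Lemma upd_np m i z j : upd m (Negz i) z (Posz j) = m (Posz j).
Proof. by rewrite /upd; case: eqP. Qed.

Lemma upd_pn m i z j : upd m (Posz i) z (Negz j) = m (Negz j).
Proof. by rewrite /upd; case: eqP. Qed.

Lemma upd_pp m i z j : upd m (Posz i) z (Posz j) = if j == i then z else m (Posz j).
Proof. by rewrite /upd; do 2 case: eqP => //; [move=> ne [/ne]|move=> -> /(_ erefl)]. Qed.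

Definition updE := (upd_nn, upd_np, upd_pn, upd_pp).

(* Scalars live at negative addresses; entry e of array a < 4 lives at 4e + a. *)
Definition var (i : nat) : expr := Const (Negz i).
Definition get (i : nat) : expr := Reg (var i).
Definition cst (i : nat) : expr := Const (Posz i).
Definition arr (a : nat) (e : expr) : expr := Add (Mul (cst 4) e) (cst a).

Definition For (i : nat) (bd : expr) (c : cmd) : cmd :=
  Seq (Store (var i) (cst 0))
      (While (Sub bd (get i)) (Seq c (Store (var i) (Add (get i) (cst 1))))).

Definition frame (L As : seq nat) (m m' : memory) : Prop :=
  (forall i, i \notin L -> m' (Negz i) = m (Negz i)) /\
  (forall a e, (a < 4)%N -> a \notin As ->
     m' (Posz (4 * e + a)) = m (Posz (4 * e + a))).

Lemma frame_refl L As m : frame L As m m. Proof. by []. Qed.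

Lemma frame_trans L As m1 m2 m3 :
  frame L As m1 m2 -> frame L As m2 m3 -> frame L As m1 m3.
Proof.
move=> [h1 h2] [h3 h4]; split=> [i hi|a e ha hA]; first by rewrite h3 ?h1.
by rewrite h4 ?h2.
Qed.

Lemma frame_sub L As L' As' m m' : {subset L <= L'} -> {subset As <= As'} ->
  frame L As m m' -> frame L' As' m m'.
Proof.
move=> sL sA [h1 h2]; split=> [i hi|a e ha hA].
  by apply: h1; apply: contra hi => /sL.
by apply: h2 => //; apply: contra hA => /sA.
Qed.

Lemma frame_var L As i z m m' : i \in L ->
  frame L As m m' -> frame L As m (upd m' (Negz i) z).
Proof.
move=> hi [h1 h2]; split=> [j hj|a e ha hA]; rewrite updE ?h2 //.
by case: eqP hj => [->|_ hj]; rewrite ?hi // h1.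
Qed.

Lemma frame_arr L As a e z m m' : (a < 4)%N -> a \in As ->
  frame L As m m' -> frame L As m (upd m' (Posz (4 * e + a)) z).
Proof.
move=> ha hA [h1 h2]; split=> [j hj|a' e' ha' hA']; rewrite updE ?h1 //.
case: eqP => [h|_]; last by rewrite h2.
have ea : a' = a by lia.
by rewrite ea hA in hA'.
Qed.

Definition keep (r : seq bool) (o : seq int) (P : memory -> Prop) (s : state) :=
  [/\ coins s = r, output s = o & P (regs s)].

Section Rules.
Variables (x : seq int) (b N : nat).
Local Notation wp := (wpre x b N).

(** The guard re-evaluates [bd] in each round, so the invariant must fix its value. That value [B0]
    is kept apart from the number [M] of rounds because it may be negative: the bound n - 1 for n =
    0 allows no round. *)
Lemma wp_for i bd c Q s M B0 (J : nat -> state -> Prop) :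
  (M <= N)%N -> (M < 2 ^ b)%N ->
  (forall j : nat, (0 < B0 - j%:Z) = (j < M)%N) ->
  J 0%N (State (upd (regs s) (Negz i) 0) (coins s) (output s)) ->
  (forall j s', J j s' -> value x (regs s') bd = B0) ->
  (forall j s', (j < M)%N -> regs s' (Negz i) = j%:Z -> J j s' ->
     wp c (fun s'' => regs s'' (Negz i) = j%:Z /\
        J j.+1 (State (upd (regs s'') (Negz i) j.+1%:Z) (coins s'') (output s''))) s') ->
  (forall s', regs s' (Negz i) = M%:Z -> J M s' -> Q s') ->
  wp (For i bd c) Q s.
Proof.
move=> MN Mb hB J0 hbd hc hQ /=; split; first by rewrite expn_gt0.
exists M; split=> //.
set s0 := State _ _ _; have : regs s0 (Negz i) = 0%N by rewrite /= updE eqxx.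
move: J0; rewrite -/s0; move: s0 => s0.
suff H d j s1 : (d + j = M)%N -> J j s1 -> regs s1 (Negz i) = j ->
    loop x (Sub bd (get i)) (wp (Seq c (Store (var i) (Add (get i) (cst 1))))) Q d s1.
  by move=> J0 h0; apply: H J0 h0; rewrite addn0.
elim: d j s1 => [|d IH] j s1 hd hJ hj /=.
  rewrite (hbd _ _ hJ) hj; have := hB j; rewrite -hd add0n ltnn => h; split; first by rewrite leNgt h.
  by apply: hQ; rewrite -hd add0n.
rewrite (hbd _ _ hJ) hj hB; have jM : (j < M)%N by lia.
split=> //; apply: wp_weaken (hc _ _ jM hj hJ) => s' [hi hJ'].
rewrite hi (_ : j%:Z + 1%:Z = j.+1%:Z); last by lia.
split; first by apply: leq_ltn_trans Mb.
by apply: (IH j.+1) => //=; [rewrite -hd addnS|rewrite updE eqxx].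
Qed.

Lemma wp_for_keep i bd c M B0 (J : nat -> memory -> Prop) m r o P :
  (M <= N)%N -> (M < 2 ^ b)%N ->
  (forall j : nat, (0 < B0 - j%:Z) = (j < M)%N) ->
  J 0%N (upd m (Negz i) 0) ->
  (forall j m', J j m' -> value x m' bd = B0) ->
  (forall j m', (j < M)%N -> m' (Negz i) = j%:Z -> J j m' ->
     wp c (keep r o (fun m'' => m'' (Negz i) = j%:Z /\
        J j.+1 (upd m'' (Negz i) j.+1%:Z))) (State m' r o)) ->
  (forall m', m' (Negz i) = M%:Z -> J M m' -> P m') ->
  wp (For i bd c) (keep r o P) (State m r o).
Proof.
move=> MN Mb hB J0 hbd hc hQ.
apply: (@wp_for _ _ _ _ _ M B0 (fun j => keep r o (J j))) => //=.
- by move=> j s' [_ _]; apply: hbd.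
- move=> j [m' r' o'] jM /= hi [/= er eo hJ]; rewrite er eo.
  by apply: wp_weaken (hc _ _ jM hi hJ) => s' [? ? [? ?]]; split.
- by move=> s' hi [er eo hJ]; split=> //; apply: hQ.
Qed.

Lemma wp_seq_keep c1 c2 Q m r o P :
  wp c1 (keep r o P) (State m r o) ->
  (forall m', P m' -> wp c2 Q (State m' r o)) ->
  wp (Seq c1 c2) Q (State m r o).
Proof.
by move=> h1 h2; apply: wp_weaken h1 => - [m' r' o'] [/= -> -> /h2].
Qed.

Lemma wp_keep_weaken c m r o P Q :
  wp c (keep r o P) (State m r o) ->
  (forall m', P m' -> Q (State m' r o)) -> wp c Q (State m r o).
Proof.
by move=> h1 h2; apply: wp_weaken h1 => - [m' r' o'] [/= -> -> /h2].
Qed.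
End Rules.

Lemma partial_sumS (R : nmodType) (I : finType) (idx : I -> nat) (F : I -> R) i :
  injective idx ->
  \sum_(j | (idx j < (idx i).+1)%N) F j = \sum_(j | (idx j < idx i)%N) F j + F i.
Proof.
move=> idx_inj; rewrite (bigD1 i) //= addrC; congr (_ + _); apply: eq_bigl => j.
rewrite ltnS; apply/andP/idP => [[h ne]|h].
  rewrite ltn_neqAle h andbT; apply: contra ne => /eqP /idx_inj ->; exact: eqxx.
by split; [apply: ltnW|apply: contraTneq h => ->; rewrite ltnn].
Qed.

(** * The program *)

Section Params.
Variables (k : nat) (xs : nat -> nat).
Local Notation p := (xs 0%N).
Local Notation q := (xs 1%N).
Local Notation n := (xs 2%N).

Definition edge_bit (e : nat) : nat := xs (3 + e * k.+1).
Definition edge_wt (e i : nat) : nat := xs (4 + e * k.+1 + i).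

(** One more than the number of vertex pairs, so that the base stays positive for n = 0. *)
Definition digit_base : nat := (n * n + 1)%N.
Definition cap : nat := (n * n * q %/ p)%N.
(** A cover has n edges of scaled weight at most [cap], so adding the profiles of its edges never
    produces a carry. *)
Definition radix : nat := (n * cap + 1)%N.
Definition nscales : nat := (digit_base ^ k)%N.
Definition nprofiles : nat := (radix ^ k)%N.
(* Union bound: nscales * nprofiles classes, each failing to be isolated with
   probability at most n^2 / 2^rho, where 2^rho >= min_labels. *)
Definition min_labels : nat := (2 * (n * n) * nscales * nprofiles)%N.
(* Larger than the label of any cover, so that an exponent determines both the
   profile and the label. *)
Definition shift : nat := (2 * n * min_labels + 1)%N.
Definition nexps : nat := (nprofiles * shift)%N.
(* Exceeds twice the number of permutations. *)
Definition packing : nat := (2 * n ^ n + 1)%N.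

(* The i-th digit of c guesses the heaviest edge for objective i. *)
Definition scale (c i : nat) : nat :=
  (edge_wt (c %/ digit_base ^ i %% digit_base) i * p %/ (n * q) + 1)%N.
Definition scaled_wt (c e i : nat) : nat := (edge_wt e i %/ scale c i)%N.

(** An oversized digit is skipped without a shift, as in the program. The matrix uses the number for
    light edges only, but it stays below [radix ^ j] in every case, as the bit bounds require. *)
Fixpoint profile (c e j : nat) : nat :=
  if j is j'.+1 then
    let w := scaled_wt c e j' in
    if (w <= cap)%N then (profile c e j' * radix + w)%N else profile c e j'
  else 0%N.

Definition light (c e j : nat) : bool :=
  all (fun i => scaled_wt c e i <= cap)%N (iota 0 j).

Definition exponent (c : nat) (rr : nat -> nat) (e : nat) : nat :=
  (profile c e k * shift + rr e)%N.

Definition entry (c : nat) (rr : nat -> nat) (e : nat) : nat :=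
  if (0 < edge_bit e)%N && light c e k then (packing ^ exponent c rr e)%N else 0%N.
End Params.

(** * The commands *)

Section Program.
Variable k : nat.

Definition pE := Inp (cst 0).
Definition qE := Inp (cst 1).
Definition nE := Inp (cst 2).
Definition n2E := Mul nE nE.
(** Unrolled, since the exponent is always [k], a constant of the program. *)
Definition powE (e : expr) (j : nat) : expr := iter j (fun f => Mul f e) (cst 1).
Definition digit_baseE := Add n2E (cst 1).
Definition capE := Div (Mul n2E qE) pE.
Definition radixE := Add (Mul nE capE) (cst 1).
Definition nscalesE := powE digit_baseE k.
Definition nprofilesE := powE radixE k.
Definition min_labelsE := Mul (Mul (Mul (cst 2) n2E) nscalesE) nprofilesE.
Definition shiftE := Add (Mul (Mul (cst 2) nE) min_labelsE) (cst 1).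
Definition nexpsE := Mul nprofilesE shiftE.

Definition modE (a d : expr) := Sub a (Mul d (Div a d)).
(* The Kronecker delta: 1 / (1 + z^2) rounds down to 0 unless z = 0. *)
Definition deltaE (a d : expr) :=
  Div (cst 1) (Add (cst 1) (Mul (Sub a d) (Sub a d))).
Definition edge_bitE (e : expr) := Inp (Add (cst 3) (Mul e (cst k.+1))).
Definition edge_wtE (e i : expr) :=
  Inp (Add (Add (cst 4) (Mul e (cst k.+1))) i).
Definition at2 (a : nat) (u v : expr) := Reg (arr a (Add (Mul u nE) v)).

Fixpoint seqs (cs : seq cmd) : cmd :=
  match cs with
  | [::] => Skip
  | [:: c] => c
  | c :: cs => Seq c (seqs cs)
  end.

(* Arrays 0 to 3 hold the labels, the matrix A, the current matrix M of the
   Faddeev-LeVerrier recursion, and A * M. *)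
Definition vX := 0%N. Definition vE := 1%N. Definition vA := 2%N.
Definition vR := 3%N. Definition vF := 4%N. Definition vC := 5%N.
Definition vW := 6%N. Definition vD := 7%N. Definition vO := 8%N.
Definition vI := 9%N. Definition vS := 10%N. Definition vP := 11%N.
Definition vJ := 12%N. Definition vL := 13%N. Definition vT := 14%N.
Definition vK := 15%N. Definition vU := 16%N. Definition vV := 17%N.
Definition vB := 18%N.

Definition set_var (i : nat) (e : expr) : cmd := Store (var i) e.

Definition packing_cmd : cmd :=
  Seq (set_var vX (cst 2))
  (Seq (For vE nE (set_var vX (Mul (get vX) nE)))
       (set_var vX (Add (get vX) (cst 1)))).

(** [vR] runs through the powers of 2 up to the first that reaches [min_labels], so the number of
    flips is the same for all outcomes. *)
Definition draw_label_cmd : cmd :=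
  While (Sub min_labelsE (get vR))
    (Seq (Flip (var vF))
    (Seq (set_var vA (Add (Add (get vA) (get vA)) (get vF)))
         (set_var vR (Add (get vR) (get vR))))).

Definition labels_cmd : cmd :=
  For vE n2E
    (Seq (set_var vA (cst 0))
    (Seq (set_var vR (cst 1))
    (Seq draw_label_cmd
         (Store (arr 0 (get vE)) (get vA))))).

(** [vD] holds the digits of the guess not yet consumed. [vO] starts as the edge bit and is cleared
    as soon as one objective makes the edge too heavy. *)
Definition profile_cmd : cmd :=
  For vI (cst k)
    (Seq (set_var vS (Div (edge_wtE (get vE) (get vI))
       (Add (Div (Mul (edge_wtE (modE (get vD) digit_baseE) (get vI)) pE) (Mul nE qE)) (cst 1))))
    (Seq (If (Sub (Add capE (cst 1)) (get vS))
             (set_var vW (Add (Mul (get vW) radixE) (get vS)))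
             (set_var vO (cst 0)))
         (set_var vD (Div (get vD) digit_baseE)))).

Definition power_cmd : cmd :=
  Seq (set_var vP (cst 1))
      (For vJ (Add (Mul (get vW) shiftE) (Reg (arr 0 (get vE))))
         (set_var vP (Mul (get vP) (get vX)))).

Definition entries_cmd : cmd :=
  For vE n2E
    (Seq (set_var vW (cst 0))
    (Seq (set_var vD (get vC))
    (Seq (set_var vO (edge_bitE (get vE)))
    (Seq profile_cmd
    (Seq (If (get vO) power_cmd (set_var vP (cst 0)))
         (Store (arr 1 (get vE)) (get vP))))))).

Definition rowE := Div (get vE) nE.
Definition colE := modE (get vE) nE.

Definition product_cmd : cmd :=
  For vE n2E
    (Seq (set_var vA (cst 0))
    (Seq (For vK nE
            (set_var vA (Add (get vA) (Mul (at2 1 rowE (get vK)) (at2 2 (get vK) colE)))))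
    (Seq (Store (arr 3 (get vE)) (get vA))
         (set_var vT (Add (get vT) (Mul (deltaE rowE colE) (get vA))))))).

Definition faddeev_cmd : cmd :=
  Seq (For vE n2E (Store (arr 2 (get vE)) (deltaE rowE colE)))
      (For vL (Sub nE (cst 1))
         (Seq (set_var vT (cst 0))
         (Seq product_cmd
              (For vE n2E (Store (arr 2 (get vE))
                 (Sub (Reg (arr 3 (get vE)))
                    (Mul (deltaE rowE colE)
                         (Div (get vT) (Add (get vL) (cst 1)))))))))).

Definition flagE (u v : expr) : expr :=
  let y := Mul (at2 1 u v) (at2 2 v u) in
  let qq := Div (Add (Add y y) (get vP)) (Add (get vP) (get vP)) in
  Div (Add (Sub qq (Mul (get vX) (Div qq (get vX)))) (Sub (get vX) (cst 1)))
      (get vX).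

Definition sqE (e : expr) := Mul e e.

Definition check_cmd : cmd :=
  Seq (set_var vB (cst 0))
      (For vU nE
         (Seq (set_var vA (cst 0))
         (Seq (set_var vT (cst 0))
         (Seq (For vV nE
                 (Seq (set_var vA (Add (get vA) (flagE (get vU) (get vV))))
                      (set_var vT (Add (get vT) (flagE (get vV) (get vU))))))
              (* Conditions only test positivity; a sum of squares is positive iff the row sum or
                 the column sum differs from 1. *)
              (If (Add (sqE (Sub (get vA) (cst 1))) (sqE (Sub (get vT) (cst 1))))
                  (set_var vB (cst 1)) Skip))))).

(** The length n can be written ahead of the edges, because only permutations pass the check. *)
Definition print_cmd : cmd :=
  Seq (Write nE)
      (For vE n2E (If (flagE rowE colE) (Seq (Write rowE) (Write colE)) Skip)).

Definition decode_cmd : cmd :=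
  Seq (set_var vP (cst 1))
      (For vS nexpsE
         (Seq check_cmd
         (Seq (If (Sub (cst 1) (get vB)) print_cmd Skip)
              (set_var vP (Mul (get vP) (get vX)))))).

Definition acc_cmd : cmd :=
  Seq packing_cmd
  (Seq labels_cmd
       (For vC nscalesE (Seq entries_cmd (Seq faddeev_cmd decode_cmd)))).
End Program.

(** * Correctness of the commands within the bit and round bounds *)

Section Blocks.
Variables (k : nat) (x : seq int) (xs : nat -> nat) (b N : nat).
Hypothesis xE : forall j, nth 0 x j = (xs j)%:Z.
Local Notation p := (xs 0%N).
Local Notation q := (xs 1%N).
Local Notation n := (xs 2%N).
Local Notation wp := (wpre x b N).
Local Notation val := (value x).
Local Notation X := (packing xs).

Lemma val_inp m e (j : nat) : val m e = j%:Z -> val m (Inp e) = (xs j)%:Z.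
Proof. by move=> /= ->; rewrite /inp_at xE. Qed.

Lemma val_add m e f (i j : nat) : val m e = i%:Z -> val m f = j%:Z ->
  val m (Add e f) = (i + j)%:Z.
Proof. by move=> /= -> ->. Qed.

Lemma val_mul m e f (i j : nat) : val m e = i%:Z -> val m f = j%:Z ->
  val m (Mul e f) = (i * j)%:Z.
Proof. by move=> /= -> ->. Qed.

Lemma val_div m e f (i j : nat) : val m e = i%:Z -> val m f = j%:Z ->
  val m (Div e f) = (i %/ j)%N%:Z.
Proof. by move=> /= -> ->; rewrite divz_nat. Qed.

Lemma val_mod m e f (i j : nat) : val m e = i%:Z -> val m f = j%:Z ->
  val m (modE e f) = (i %% j)%N%:Z.
Proof. by move=> /= -> ->; rewrite divz_nat {1}(divn_eq i j); lia. Qed.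

Lemma val_pow m e i j : val m e = i%:Z -> val m (powE e j) = (i ^ j)%:Z.
Proof.
by move=> he; elim: j => // j IH; rewrite expnSr; apply: val_mul.
Qed.

Lemma val_sub m e f y z : val m e = y -> val m f = z -> val m (Sub e f) = y - z.
Proof. by move=> /= -> ->. Qed.

Lemma val_get m i z : m (Negz i) = z -> val m (get i) = z. Proof. by []. Qed.

Lemma val_arr m a e (j : nat) : val m e = j%:Z -> val m (arr a e) = (4 * j + a)%:Z.
Proof. by move=> he; apply: val_add => //; apply: val_mul. Qed.

Lemma val_delta m e f (i j : nat) : val m e = i%:Z -> val m f = j%:Z ->
  val m (deltaE e f) = (i == j)%:Z.
Proof.
move=> /= -> ->; case: eqP => [->|ne]; first by rewrite subrr.
have : 0 < (i%:Z - j%:Z) * (i%:Z - j%:Z) by nia.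
by move: (_ * _) => z z0; apply: divz_small; apply/andP; split; lia.
Qed.

Ltac nval := repeat first
  [ apply: val_inp | apply: val_add | apply: val_mul | apply: val_div
  | apply: val_mod | apply: val_pow | apply: val_arr | reflexivity | eassumption].

Lemma val_n m : val m nE = n. Proof. by nval. Qed.
Lemma val_n2 m : val m n2E = (n * n)%:Z. Proof. by nval. Qed.
Lemma val_base m : val m digit_baseE = digit_base xs. Proof. by nval. Qed.
Lemma val_cap m : val m capE = cap xs. Proof. by nval. Qed.
Lemma val_radix m : val m radixE = radix xs. Proof. by nval. Qed.
Lemma val_nscales m : val m (nscalesE k) = nscales k xs.
Proof. by nval; apply: val_base. Qed.
Lemma val_nprofiles m : val m (nprofilesE k) = nprofiles k xs.
Proof. by nval; apply: val_radix. Qed.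
Lemma val_min_labels m : val m (min_labelsE k) = min_labels k xs.
Proof.
by apply: val_mul (val_nprofiles m); apply: val_mul (val_nscales m); nval.
Qed.
Lemma val_shift m : val m (shiftE k) = shift k xs.
Proof. by apply: val_add => //; apply: val_mul (val_min_labels m); nval. Qed.
Lemma val_nexps m : val m (nexpsE k) = nexps k xs.
Proof. exact: val_mul (val_nprofiles m) (val_shift m). Qed.

(** Factor by which one Faddeev-LeVerrier step can enlarge the entries: n for the matrix product and
    n^3 for the accumulated trace, bounded as a sum over n^2 pairs. The 1 keeps it positive for n =
    0. *)
Definition growth : nat := ((n ^ 3 + n + 1) * X ^ nexps k xs)%N.

Hypothesis x_bound : forall j, (xs j < 2 ^ b)%N.
Hypothesis N_bound : (N < 2 ^ b)%N.
Hypothesis growth_bound : (growth ^ n.+1 < 2 ^ b)%N.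
Hypothesis k_le : (k <= N)%N.
Hypothesis n_le : (n <= N)%N.
Hypothesis n2_le : (n * n <= N)%N.
Hypothesis nscales_le : (nscales k xs <= N)%N.
Hypothesis nexps_le : (nexps k xs <= N)%N.
Hypothesis labels_le : (2 * min_labels k xs + 1 <= N)%N.

Lemma packing_gt0 : (0 < X)%N. Proof. by rewrite /packing addn1. Qed.

Lemma nexps_gt0 : (0 < nexps k xs)%N.
Proof. by rewrite muln_gt0 expn_gt0 /radix /shift !addn1. Qed.

Lemma growth_gt0 : (0 < growth)%N.
Proof. by rewrite muln_gt0 expn_gt0 packing_gt0 addn1. Qed.

Lemma growth_exp_lt j : (j <= n.+1)%N -> (growth ^ j < 2 ^ b)%N.
Proof.
by move=> h; apply: leq_ltn_trans growth_bound; rewrite leq_pexp2l ?growth_gt0.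
Qed.

Lemma packing_exp_le j : (j <= nexps k xs)%N -> (X ^ j <= growth)%N.
Proof.
move=> h; apply: (@leq_trans (X ^ nexps k xs)); first by rewrite leq_pexp2l ?packing_gt0.
by rewrite leq_pmull // addn1.
Qed.

Lemma packing_exp_lt j : (j <= nexps k xs)%N -> (X ^ j < 2 ^ b)%N.
Proof.
move=> h; apply: leq_ltn_trans (packing_exp_le h) _.
by rewrite -(expn1 growth) growth_exp_lt.
Qed.

Lemma lt_pow_b M : (M <= N)%N -> (M < 2 ^ b)%N.
Proof. by move=> h; apply: leq_ltn_trans N_bound. Qed.

Lemma wp_store a e m r o adr z Q :
  val m a = adr -> val m e = z -> (`|z| < 2 ^ b)%N ->
  Q (State (upd m adr z) r o) -> wp (Store a e) Q (State m r o).
Proof. by move=> /= -> ->. Qed.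

Lemma wp_seq c1 c2 Q s : wp c1 (wp c2 Q) s -> wp (Seq c1 c2) Q s.
Proof. by []. Qed.

Lemma wp_flip i m (d : bool) r o Q :
  Q (State (upd m (Negz i) (nat_of_bool d)) r o) ->
  wp (Flip (var i)) Q (State m (d :: r) o).
Proof. by []. Qed.

Lemma wp_set i e m r o (z : nat) Q :
  val m e = z -> (z < 2 ^ b)%N ->
  Q (State (upd m (Negz i) z) r o) -> wp (set_var i e) Q (State m r o).
Proof. by move=> /= ->. Qed.

#[local] Arguments wpre : simpl never.

Lemma wp_loop i bd c M (J : nat -> memory -> Prop) m r o P :
  (M <= N)%N ->
  J 0%N (upd m (Negz i) 0) ->
  (forall j m', J j m' -> val m' bd = M) ->
  (forall j m', (j < M)%N -> m' (Negz i) = j%:Z -> J j m' ->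
     wp c (keep r o (fun m'' => m'' (Negz i) = j%:Z /\
        J j.+1 (upd m'' (Negz i) j.+1%:Z))) (State m' r o)) ->
  (forall m', m' (Negz i) = M%:Z -> J M m' -> P m') ->
  wp (For i bd c) (keep r o P) (State m r o).
Proof.
move=> MN; apply: wp_for_keep => //; first exact: lt_pow_b.
by move=> j; rewrite subr_gt0.
Qed.

Ltac fr := repeat first [ apply: frame_refl | assumption
  | (apply: frame_var; [by []|]) | (apply: frame_arr; [by []|by []|]) ].

Lemma packing_spec m r o :
  wp packing_cmd (keep r o (fun m' => frame [:: vX; vE] [::] m m' /\
    m' (Negz vX) = X)) (State m r o).
Proof.
have X_lt : (X < 2 ^ b)%N by rewrite -(expn1 X) packing_exp_lt ?nexps_gt0.
have pow_le j : (j <= n)%N -> (2 * n ^ j < X)%N.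
  move=> jn; rewrite /packing addn1 ltnS leq_mul2l /=.
  case: (posnP n) => [n0|n0]; last by rewrite leq_pexp2l.
  by move: jn; rewrite {1}n0 leqn0 => /eqP ->; rewrite expn0 expn_gt0 n0.
apply: wp_seq; apply: (wp_set (z := 2)) => //.
  by have := ltn_trans (pow_le _ (leq0n n)) X_lt; rewrite expn0.
apply: (wp_seq_keep (P := fun m' => frame [:: vX; vE] [::] m m' /\ m' (Negz vX) = (2 * n ^ n)%:Z)).
  apply: (wp_loop (M := n) (J := fun j m' => frame [:: vX; vE] [::] m m' /\
     m' (Negz vX) = (2 * n ^ j)%:Z)) => //.
  - by split; rewrite ?updE //; fr.
  - by move=> j m' _; apply: val_n.
  - move=> j m' jn hj [fr0 hX]; apply: (wp_set (z := (2 * n ^ j.+1)%N)).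
    + by rewrite expnSr mulnA; apply: val_mul (val_n _).
    + exact: ltn_trans (pow_le _ _) X_lt.
    + by split; rewrite ?updE //; split; rewrite ?updE //; split; rewrite ?updE //; fr.
move=> m' [fr0 hX]; apply: (wp_set (z := X)) => //.
  exact: (@val_add m' (get vX) (cst 1) (2 * n ^ n) 1 hX).
by split=> //; split; rewrite ?updE //; fr.
Qed.

Local Notation Q := (min_labels k xs).
Local Notation rho := (up_log 2 Q).

Lemma ltn_label_bits j : (2 ^ j < Q)%N = (j < rho)%N.
Proof.
apply/idP/idP; rewrite !ltnNge; apply: contra => h; last exact: up_log_min.
by apply: leq_trans (up_logP Q (isT : 1 < 2)%N) _; rewrite leq_exp2l.
Qed.

(** The last doubling starts below Q, so it ends below 2 Q; the + 1 covers Q = 0, which happens for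
    n = 0. *)
Lemma label_bits_exp_le j : (j <= rho)%N -> (2 ^ j <= 2 * Q + 1)%N.
Proof.
case: j => [|j] hj; first by rewrite expn0 addn1.
by rewrite expnS addn1 ltnW // ltnS leq_mul2l /= ltnW // ltn_label_bits.
Qed.

Lemma label_bits_le : (rho <= N)%N.
Proof.
apply: leq_trans labels_le; apply: (@leq_trans Q); last by lia.
by apply: up_log_min => //; apply: ltnW; apply: ltn_expl.
Qed.

Lemma draw_label_spec (m : memory) r o : (rho <= size r)%N ->
  m (Negz vA) = 0 -> m (Negz vR) = 1 ->
  wp (draw_label_cmd k) (keep (drop rho r) o (fun m' =>
    frame [:: vA; vR; vF] [::] m m' /\ m' (Negz vA) = bin_val (take rho r)))
    (State m r o).
Proof.
move=> hr hA hR; exists rho; split; first exact: label_bits_le.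
suff H d j m' : (d + j = rho)%N -> frame [:: vA; vR; vF] [::] m m' ->
    m' (Negz vA) = bin_val (take j r) -> m' (Negz vR) = (2 ^ j)%:Z ->
    loop x (Sub (min_labelsE k) (get vR)) (wp (Seq (Flip (var vF))
      (Seq (set_var vA (Add (Add (get vA) (get vA)) (get vF)))
           (set_var vR (Add (get vR) (get vR)))))) (keep (drop rho r) o (fun m' =>
    frame [:: vA; vR; vF] [::] m m' /\ m' (Negz vA) = bin_val (take rho r))) d
      (State m' (drop j r) o).
  by have := H rho 0%N m; rewrite addn0 take0 drop0; apply.
elim: d j m' => [|d IH] j m' hd fr0 hA' hR';
  have hc := val_sub (val_min_labels m') (val_get hR').
  have ej : j = rho by lia.
  split; last by split; rewrite -?ej.
  by rewrite [regs _]/= hc ej subr_le0 lez_nat up_logP.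
have jr : (j < rho)%N by lia.
split; first by rewrite [regs _]/= hc subr_gt0 ltz_nat ltn_label_bits.
have eA : bin_val (take j.+1 r) = (bin_val (take j r) + bin_val (take j r) + nth false r j)%N.
  by rewrite (take_nth false (leq_trans jr hr)) bin_val_rcons.
have h2 := leq_ltn_trans (label_bits_exp_le jr) (lt_pow_b labels_le).
rewrite (drop_nth false (leq_trans jr hr)).
apply: wp_seq; apply: wp_flip; apply: wp_seq.
apply: (wp_set (z := bin_val (take j.+1 r))).
- by rewrite /= !updE /= hA' eA.
- apply: ltn_trans h2; apply: leq_trans (bin_val_lt _) _.
  by rewrite leq_exp2l // size_take_min geq_minl.
apply: (wp_set (z := (2 ^ j.+1)%N)) => //.
  by rewrite /= !updE /= hR' -PoszD addnn -mul2n -expnS.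
apply: IH => //; rewrite ?updE //; first by rewrite -hd addnS.
by fr.
Qed.

Lemma labels_spec (m : memory) r o : (n * n * rho <= size r)%N ->
  wp (labels_cmd k) (keep (drop (n * n * rho) r) o (fun m' =>
    frame [:: vE; vA; vR; vF] [:: 0%N] m m' /\
    forall e, (e < n * n)%N -> m' (Posz (4 * e + 0)) = bin_val (block rho r e)))
    (State m r o).
Proof.
move=> hr.
apply: (@wp_for _ _ _ _ _ _ _ _ (n * n)%N (n * n)%N%:Z (fun j => keep (drop (j * rho) r) o (fun m' =>
    frame [:: vE; vA; vR; vF] [:: 0%N] m m' /\
    forall e, (e < j)%N -> m' (Posz (4 * e + 0)) = bin_val (block rho r e)))) => //=.
- exact: lt_pow_b.
- by move=> j; rewrite subr_gt0.
- by rewrite mul0n drop0; split=> //; split; [fr|].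
- by move=> j [m' r' o'] _; apply: val_n2.
move=> j [m' r' o'] jn /= hj [/= -> -> [fr0 hm]].
apply: wp_seq; apply: (wp_set (z := 0)) => //; first by rewrite expn_gt0.
apply: wp_seq; apply: (wp_set (z := 1)) => //; first exact: lt_pow_b (leq_trans (leq_addl _ 1) labels_le).
have hs : (rho <= size (drop (j * rho) r))%N.
  rewrite size_drop leq_subRL; last by apply: leq_trans hr; rewrite leq_mul2r ltnW ?orbT.
  by apply: leq_trans hr; rewrite -mulSnr leq_mul2r jn orbT.
apply: wp_seq; apply: wp_weaken (draw_label_spec o hs _ _); rewrite ?updE //=.
move=> [m2 r2 o2] [/= -> -> [fr2 hA2]].
have hE : m2 (Negz vE) = j by rewrite fr2.1 // !updE.
apply: (wp_store (adr := (4 * j + 0)%N) (z := bin_val (take rho (drop (j * rho) r)))) => //.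
- exact: val_arr.
- apply: leq_trans (bin_val_lt _) _; rewrite (@leq_trans (2 ^ rho)) //.
    by rewrite leq_exp2l // size_take_min geq_minl.
  by apply: leq_trans (ltnW (lt_pow_b labels_le)); apply: label_bits_exp_le.
split; first by rewrite /= !updE.
split=> //=; first by rewrite drop_drop mulSn addnC.
split.
  apply: frame_var => //; apply: frame_arr => //.
  apply: frame_trans (frame_sub _ _ fr2); first by fr.
    by apply/allP.
  by [].
move=> e; rewrite ltnS leq_eqVlt !updE => /orP [/eqP ->|ej].
  rewrite eqxx; congr (Posz (bin_val _)).
  apply: (@eq_from_nth _ false).
    by rewrite size_mkseq size_take_min; apply/minn_idPl.
  move=> i; rewrite size_take_min => /leq_trans/(_ (geq_minl _ _)) hi.
  by rewrite nth_take // nth_drop nth_mkseq.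
case: eqP => [h|_]; first by lia.
rewrite (fr2.2 0%N e) // !updE; exact: hm.
Qed.

Lemma wp_if_keep e c1 c2 m r o (z : int) P : val m e = z ->
  (0 < z -> wp c1 (keep r o P) (State m r o)) ->
  (z <= 0 -> wp c2 (keep r o P) (State m r o)) ->
  wp (If e c1 c2) (keep r o P) (State m r o).
Proof. by rewrite /wpre -/wp => -> h1 h2; case: ltP => h; [apply: h1|apply: h2]. Qed.

Lemma profile_lt c e j : (0 < n)%N -> (profile k xs c e j < radix xs ^ j)%N.
Proof.
move=> n0; elim: j => //= j IH; rewrite expnSr.
have cr : (cap xs < radix xs)%N by rewrite /radix addn1 ltnS leq_pmull.
case: ifP => h.
  have := leq_trans (leq_ltn_trans h cr) (leqnn _).
  by move: IH; set u := (radix xs ^ j)%N; set v := radix xs; nia.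
by apply: leq_trans IH _; rewrite leq_pmulr // (leq_ltn_trans _ cr).
Qed.

Lemma profile_lt_k c e j : (0 < n)%N -> (j <= k)%N ->
  (profile k xs c e j < nprofiles k xs)%N.
Proof.
by move=> n0 jk; apply: leq_trans (profile_lt c e j n0) _; rewrite leq_pexp2l // /radix addn1.
Qed.

Lemma nprofiles_le : (nprofiles k xs <= N)%N.
Proof. by apply: leq_trans nexps_le; rewrite leq_pmulr // /shift addn1. Qed.

Lemma exponent_lt c rr e : (0 < n)%N -> (rr e < 2 * Q + 1)%N ->
  (exponent k xs c rr e < nexps k xs)%N.
Proof.
move=> n0 hr; have := profile_lt_k c e n0 (leqnn k).
rewrite /exponent /nexps => lt_u; have := leq_mul lt_u (leqnn (shift k xs)).
apply: leq_trans; rewrite mulSn addnC ltn_add2r; apply: leq_trans hr _.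
by rewrite /shift leq_add2r -mulnA leq_mul2l /= leq_pmull.
Qed.

Lemma lightS c e j :
  light k xs c e j.+1 = light k xs c e j && (scaled_wt k xs c e j <= cap xs)%N.
Proof. by rewrite /light -addn1 iotaD all_cat add0n /= andbT. Qed.

Lemma val_edge_bit m e (j : nat) : val m e = j -> val m (edge_bitE k e) = edge_bit k xs j.
Proof. by move=> he; rewrite /edge_bit; nval. Qed.

Lemma val_edge_wt m e f (i j : nat) : val m e = i -> val m f = j ->
  val m (edge_wtE k e f) = edge_wt k xs i j.
Proof. by move=> he hf; rewrite /edge_wt; nval. Qed.

Lemma profile_spec c e (m : memory) r o : (0 < n)%N -> (c < nscales k xs)%N ->
  m (Negz vE) = e%:Z -> m (Negz vD) = c%:Z -> m (Negz vW) = 0 ->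
  m (Negz vO) = edge_bit k xs e ->
  wp (profile_cmd k) (keep r o (fun m' =>
    [/\ frame [:: vI; vS; vW; vO; vD] [::] m m',
        m' (Negz vW) = profile k xs c e k
      & m' (Negz vO) = (if light k xs c e k then edge_bit k xs e else 0%N)]))
    (State m r o).
Proof.
move=> n0 hc hE hD hW hO.
apply: (wp_loop (M := k) (J := fun j m' =>
  [/\ frame [:: vI; vS; vW; vO; vD] [::] m m',
      m' (Negz vD) = (c %/ digit_base xs ^ j)%N, m' (Negz vW) = profile k xs c e j
      & m' (Negz vO) = (if light k xs c e j then edge_bit k xs e else 0%N)])) => //.
- by split; rewrite ?updE ?divn1 //; fr.
- move=> j m' jk hj [fr0 hD' hW' hO'].
  have hE' : m' (Negz vE) = e by rewrite fr0.1.
  apply: wp_seq; apply: (wp_set (z := scaled_wt k xs c e j)).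
  + apply: val_div; first exact: val_edge_wt.
    apply: val_add => //; apply: val_div; last by nval.
    apply: val_mul; last by nval.
    by apply: val_edge_wt => //; apply: val_mod; [exact: hD'|exact: val_base].
  + by apply: leq_ltn_trans (leq_div _ _) (x_bound _).
  apply: (wp_seq_keep (P := fun m2 => [/\ frame [:: vI; vS; vW; vO; vD] [::] m m2,
      m2 (Negz vD) = (c %/ digit_base xs ^ j)%N, m2 (Negz vI) = j, m2 (Negz vW) = profile k xs c e j.+1
      & m2 (Negz vO) = (if light k xs c e j.+1 then edge_bit k xs e else 0%N)])).
    apply: wp_if_keep.
    * apply: val_sub; first by apply: val_add (val_cap _) _.
      by rewrite /= updE.
    * rewrite subr_gt0 ltz_nat addn1 ltnS => hw.
      apply: (wp_set (z := profile k xs c e j.+1)).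
      - have -> : profile k xs c e j.+1 = (profile k xs c e j * radix xs + scaled_wt k xs c e j)%N.
          by rewrite /= hw.
        apply: val_add; last by rewrite /= updE.
        by apply: val_mul (val_radix _); rewrite /= !updE.
      - by apply: lt_pow_b; apply: leq_trans (ltnW (profile_lt_k c e n0 jk)) nprofiles_le.
      split; split; rewrite ?updE //; first by fr.
      by rewrite lightS hw andbT.
    * rewrite subr_le0 lez_nat addn1 => hw.
      apply: (wp_set (z := 0)) => //; first by rewrite expn_gt0.
      split; split; rewrite ?updE //; first by fr.
      - by rewrite /= leqNgt hw.
      by rewrite lightS leqNgt hw andbF.
  move=> m2 [fr2 hD2 hI2 hW2 hO2].
  apply: (wp_set (z := (c %/ digit_base xs ^ j.+1)%N)).
  + by rewrite expnSr divnMA; apply: val_div (val_base _).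
  + apply: lt_pow_b; apply: leq_trans (leq_div _ _) _; exact: leq_trans (ltnW hc) nscales_le.
  split=> //; split; rewrite ?updE //; split; rewrite ?updE //; fr.
- by move=> m' _ [h1 _ h2 h3].
Qed.

Lemma power_spec (m : memory) (w t e : nat) r o : m (Negz vX) = X -> m (Negz vW) = w ->
  m (Negz vE) = e -> m (Posz (4 * e + 0)) = t ->
  (w * shift k xs + t <= nexps k xs)%N ->
  wp (power_cmd k) (keep r o (fun m' => frame [:: vJ; vP] [::] m m' /\
     m' (Negz vP) = (X ^ (w * shift k xs + t))%N)) (State m r o).
Proof.
move=> hX hW hE ht ub; set s := (w * _ + t)%N.
apply: wp_seq; apply: (wp_set (z := 1)) => //.
  exact: lt_pow_b (leq_trans (leq_addl _ 1) labels_le).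
apply: (wp_loop (M := s) (J := fun j m' => frame [:: vJ; vP] [::] m m' /\
     m' (Negz vP) = (X ^ j)%N)) => //.
- exact: leq_trans ub nexps_le.
- by rewrite !updE; split=> //; fr.
- move=> j m' [fr0 _]; apply: val_add.
    by apply: val_mul (val_shift _); rewrite /= fr0.1.
  have hE' : val m' (get vE) = e by rewrite /= fr0.1.
  by move: (val_arr 0 hE') => /= ->; rewrite fr0.2.
- move=> j m' js hj [fr0 hP]; apply: (wp_set (z := (X ^ j.+1)%N)).
  + by rewrite expnSr; apply: val_mul => //=; rewrite fr0.1.
  + by apply: packing_exp_lt; apply: leq_trans ub.
  split=> //; rewrite ?updE //; split; rewrite ?updE //; split; rewrite ?updE //; fr.
Qed.

Lemma entries_spec c rr (m : memory) r o : (c < nscales k xs)%N ->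
  (forall e, (e < n * n)%N -> (rr e < 2 * Q + 1)%N) ->
  m (Negz vX) = X -> m (Negz vC) = c ->
  (forall e, (e < n * n)%N -> m (Posz (4 * e + 0)) = rr e) ->
  wp (entries_cmd k) (keep r o (fun m' =>
    frame [:: vE; vW; vD; vO; vI; vS; vJ; vP] [:: 1%N] m m' /\
    forall e, (e < n * n)%N -> m' (Posz (4 * e + 1)) = entry k xs c rr e))
    (State m r o).
Proof.
move=> hc hrr hX hC hR.
pose L := [:: vE; vW; vD; vO; vI; vS; vJ; vP].
apply: (wp_loop (M := (n * n)%N) (J := fun j m' => frame L [:: 1%N] m m' /\
    forall e, (e < j)%N -> m' (Posz (4 * e + 1)) = entry k xs c rr e)) => //.
- by split=> //; fr.
- by move=> j m' _; apply: val_n2.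
move=> e m' en hE [fr0 hA].
have n0 : (0 < n)%N by case: (posnP n) en => // ->.
have s0 : (0 < 2 ^ b)%N by rewrite expn_gt0.
apply: wp_seq; apply: (wp_set (z := 0)) => //.
apply: wp_seq; apply: (wp_set (z := c)).
- by rewrite /= updE fr0.1.
- by apply: lt_pow_b; apply: leq_trans (ltnW hc) nscales_le.
apply: wp_seq; apply: (wp_set (z := edge_bit k xs e)).
- by apply: val_edge_bit; rewrite /= !updE.
- exact: x_bound.
apply: wp_seq.
apply: wp_keep_weaken (@profile_spec c e _ r o n0 hc _ _ _ _) _; rewrite ?updE //.
move=> m2 [fr2 hW2 hO2].
have hE2 : m2 (Negz vE) = e by rewrite fr2.1 // !updE.
have {}fr2 : frame L [::] m' m2.
  by apply: frame_trans (frame_sub _ _ fr2); [fr|apply/allP|].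
have sub1 : frame L [::] m' m2 -> frame L [:: 1%N] m' m2 by apply: frame_sub.
have frm2 := frame_trans fr0 (sub1 fr2).
have exp_lt := exponent_lt c n0 (hrr e en).
apply: (wp_seq_keep (P := fun m3 => [/\ frame L [::] m' m3, m3 (Negz vE) = e &
   m3 (Negz vP) = entry k xs c rr e])).
  apply: wp_if_keep; first exact: hO2.
    rewrite ltz_nat => hO; have lt : light k xs c e k by case: (light _ _ _ _ _) hO.
    rewrite lt in hO; apply: wp_keep_weaken.
      apply: (@power_spec m2 (profile k xs c e k) (rr e) e) => //.
      - by rewrite frm2.1.
      - by rewrite frm2.2 // hR.
      - exact: ltnW.
    move=> m3 [fr3 hP3]; split=> //=; split.
    - by apply: frame_trans fr2 (frame_sub _ _ fr3); [apply/allP|].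
    - by rewrite fr3.1.
    - by rewrite hP3 /entry hO lt.
  rewrite lez_nat leqn0 => hO; apply: (wp_set (z := 0)) => //; split; split; rewrite ?updE //.
    by fr.
  by rewrite /entry; case: (light _ _ _ _ _) hO; rewrite ?andbF // => /eqP ->.
move=> m3 [fr3 hE3 hP3].
apply: (wp_store (adr := (4 * e + 1)%N) (z := entry k xs c rr e)) => //.
- exact: val_arr.
- rewrite /= /entry; case: ifP => // _; exact: packing_exp_lt (ltnW exp_lt).
split=> //; split; first by rewrite /= updE.
split; first by apply: frame_var => //; apply: frame_arr => //; apply: frame_trans fr0 (frame_sub _ _ fr3).
move=> e'; rewrite ltnS leq_eqVlt /= !updE => /orP [/eqP ->|ee]; first by rewrite eqxx.
case: eqP => [h|_]; first by lia.
by rewrite fr3.2 // hA.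
Qed.


(** * Row-major matrices in memory and the Faddeev-LeVerrier loops *)

Definition pair_index (uv : 'I_n * 'I_n) : nat := (uv.1 * n + uv.2)%N.

Lemma pair_index_div uv : (pair_index uv %/ n)%N = uv.1.
Proof.
have := ltn_ord uv.2 => h; rewrite /pair_index divnMDl ?(leq_ltn_trans _ h) //.
by rewrite divn_small // addn0.
Qed.

Lemma pair_index_mod uv : (pair_index uv %% n)%N = uv.2.
Proof. by rewrite /pair_index modnMDl modn_small. Qed.

Lemma pair_index_inj : injective pair_index.
Proof.
move=> [u v] [u' v'] h; congr pair; apply: val_inj => /=.
  by rewrite -(pair_index_div (u, v)) h pair_index_div.
by rewrite -(pair_index_mod (u, v)) h pair_index_mod.
Qed.

Lemma pair_index_lt uv : (pair_index uv < n * n)%N.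
Proof.
rewrite /pair_index; apply: (@leq_trans (uv.1.+1 * n)); last by rewrite leq_mul2r ltn_ord orbT.
by rewrite mulSn addnC ltn_add2r.
Qed.

Lemma pair_indexP e : (e < n * n)%N -> exists uv, e = pair_index uv.
Proof.
move=> en; have n0 : (0 < n)%N by case: (posnP n) en => // ->.
have hu : (e %/ n < n)%N by rewrite ltn_divLR.
have hv : (e %% n < n)%N by rewrite ltn_mod.
by exists (Ordinal hu, Ordinal hv); rewrite /pair_index /= -divn_eq.
Qed.

Lemma val_row (m : memory) uv : m (Negz vE) = pair_index uv -> val m rowE = uv.1.
Proof.
by move=> hE; rewrite -(pair_index_div uv); apply: val_div => //; exact (val_n m).
Qed.

Lemma val_col (m : memory) uv : m (Negz vE) = pair_index uv -> val m colE = uv.2.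
Proof.
by move=> hE; rewrite -(pair_index_mod uv); apply: val_mod => //; exact (val_n m).
Qed.

Lemma val_at2 (m : memory) a e f (uv : 'I_n * 'I_n) z : val m e = uv.1 -> val m f = uv.2 ->
  m (Posz (4 * pair_index uv + a)) = z -> val m (at2 a e f) = z.
Proof.
move=> he hf <-.
have h : val m (Add (Mul e nE) f) = pair_index uv.
  by apply: val_add => //; apply: val_mul => //; exact (val_n m).
exact (congr1 m (val_arr a h)).
Qed.

Definition holds_mx (m : memory) (a : nat) (M : 'M[int]_n) : Prop :=
  forall uv, m (Posz (4 * pair_index uv + a)) = M uv.1 uv.2.

Lemma abs_sum_le (I : finType) (P : pred I) (F : I -> int) (C : nat) :
  (forall i, (`|F i| <= C)%N) -> (`|(\sum_(i | P i) F i : int)| <= #|I| * C)%N.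
Proof.
move=> h; rewrite -lez_nat abszE; apply: le_trans (ler_norm_sum _ _ _) _.
apply: (@le_trans _ _ (\sum_(i | P i) C%:Z)).
  by apply: ler_sum => i _; rewrite -abszE lez_nat.
by rewrite sumr_const PoszM -[X in X <= _]mulr_natl natz ler_wpM2r // lez_nat max_card.
Qed.

Lemma product_spec (A M : 'M[int]_n) (a g : nat) (m : memory) r o :
  (forall u v, `|A u v| <= a)%N -> (forall u v, `|M u v| <= g)%N ->
  (n ^ 3 * (a * g) < 2 ^ b)%N ->
  holds_mx m 1 A -> holds_mx m 2 M -> m (Negz vT) = 0 ->
  wp product_cmd (keep r o (fun m' =>
    [/\ frame [:: vE; vA; vK; vT] [:: 3%N] m m', holds_mx m' 3 (A *m M)
      & m' (Negz vT) = \tr (A *m M)])) (State m r o).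
Proof.
move=> hA hM hb mA mM hT.
have acc_le (P : pred 'I_n) u v : (`|(\sum_(w | P w) A u w * M w v : int)| <= n * (a * g))%N.
  by rewrite -[X in (_ <= X * _)%N](card_ord n); apply: abs_sum_le => w; rewrite abszM leq_mul.
have n3 : (n ^ 3 = n * n * n)%N by rewrite !expnS expn0 muln1 mulnA.
pose L := [:: vE; vA; vK; vT].
apply: (wp_loop (M := (n * n)%N) (J := fun e m' => [/\ frame L [:: 3%N] m m',
   (forall uv, (pair_index uv < e)%N ->
      m' (Posz (4 * pair_index uv + 3)) = (A *m M) uv.1 uv.2) &
   m' (Negz vT) = \sum_(uv | (pair_index uv < e)%N)
      (uv.1 == uv.2 :> nat)%:Z * (A *m M) uv.1 uv.2])) => //.
- by split; rewrite ?updE ?big_pred0 //; fr.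
- by move=> j m' _; apply: val_n2.
- move=> e m' en hE [fr0 h3 hT']; have [[u v] e_uv] := pair_indexP en.
  have n_acc : (n * (a * g) <= n ^ 3 * (a * g))%N.
    rewrite leq_mul2r n3 -mulnA; apply/orP; right.
    by apply: leq_pmulr; rewrite muln_gt0 (leq_ltn_trans _ (ltn_ord u)).
  apply: wp_seq; apply: (wp_set (z := 0)) => //; first by rewrite expn_gt0.
  apply: (wp_seq_keep (P := fun m2 => frame [:: vA; vK] [::] m' m2 /\
    m2 (Negz vA) = (A *m M) u v)).
    apply: (wp_loop (M := n) (J := fun j m2 => frame [:: vA; vK] [::] m' m2 /\
       m2 (Negz vA) = \sum_(w : 'I_n | (w < j)%N) A u w * M w v)) => //.
    - by split; rewrite ?updE ?big_pred0 //; fr.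
    - by move=> j m2 _; apply: val_n.
    - move=> j m2 jn hj [fr2 hS].
      have hE2 : m2 (Negz vE) = pair_index (u, v) by rewrite fr2.1 // hE e_uv.
      pose w := Ordinal jn.
      apply: (wp_store (adr := Negz vA) (z := \sum_(w : 'I_n | (w < j.+1)%N) A u w * M w v)) => //.
      + rewrite -[j]/(nat_of_ord w) (partial_sumS _ w (@ord_inj n)).
        rewrite -[LHS]/(val m2 (get vA) + val m2 (at2 1 rowE (get vK)) * val m2 (at2 2 (get vK) colE)).
        rewrite -[val m2 (get vA)]/(m2 (Negz vA)) hS.
        rewrite (@val_at2 m2 1 rowE (get vK) (u, w) (A u w)) //.
        * rewrite (@val_at2 m2 2 (get vK) colE (w, v) (M w v)) //; first exact: val_col hE2.
          by rewrite fr2.2 // fr0.2 // mM.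
        * exact: val_row hE2.
        * by rewrite fr2.2 // fr0.2 // mA.
      + apply: leq_ltn_trans (acc_le _ _ _) _; exact: leq_ltn_trans n_acc hb.
      + by split=> //=; split; rewrite ?updE //; split; rewrite ?updE //; fr.
    - move=> m2 _ [fr2 hS]; split=> //; rewrite hS mxE.
      by apply: eq_bigl => w; rewrite ltn_ord.
  move=> m2 [fr2 hS].
  have hE2 : m2 (Negz vE) = pair_index (u, v) by rewrite fr2.1 // hE e_uv.
  apply: wp_seq; apply: (wp_store (adr := (4 * pair_index (u, v) + 3)%N) (z := (A *m M) u v)) => //.
  + exact: val_arr.
  + by rewrite mxE; apply: leq_ltn_trans (acc_le _ _ _) _; exact: leq_ltn_trans n_acc hb.
  pose tr e := \sum_(uv | (pair_index uv < e)%N) (uv.1 == uv.2 :> nat)%:Z * (A *m M) uv.1 uv.2.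
  apply: (wp_store (adr := Negz vT) (z := tr e.+1)) => //.
  + rewrite /tr e_uv (partial_sumS _ _ pair_index_inj) -e_uv -hT'.
    set m3 := upd _ _ _.
    have hE3 : m3 (Negz vE) = pair_index (u, v) by rewrite /m3 updE.
    rewrite -[LHS]/(m3 (Negz vT) + val m3 (deltaE rowE colE) * m3 (Negz vA)).
    rewrite (val_delta (val_row hE3) (val_col hE3)) /m3 !updE hS fr2.1 //.
  + have le1 (M' : 'M[int]_n) (F : 'I_n * 'I_n -> int) : (forall uv, `|F uv| <= n * (a * g))%N ->
      forall P, (`|(\sum_(uv | P uv) F uv : int)| <= n ^ 3 * (a * g))%N.
      move=> hF P; have := @abs_sum_le _ P F _ hF.
      by rewrite card_prod !card_ord n3 !mulnA.
    apply: leq_ltn_trans hb; apply: (le1 A) => uv.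
    rewrite abszM mxE -[X in (_ <= X)%N]mul1n; apply: leq_mul; last exact: acc_le.
    by case: (_ == _).
  split=> //=; split; first by rewrite !updE fr2.1.
  split.
  + fr; apply: frame_trans fr0 (frame_sub _ _ fr2); [by apply/allP|by []].
  + move=> uv; rewrite !updE ltnS leq_eqVlt => /orP [/eqP h|h].
      have -> : uv = (u, v) by apply: pair_index_inj; rewrite h e_uv.
      by rewrite eqxx.
    case: eqP => [h'|_]; first by lia.
    by rewrite fr2.2 // h3.
  + by rewrite !updE.
- move=> m' _ [fr0 h3 hT']; split=> //; first by move=> uv; apply: h3; apply: pair_index_lt.
  rewrite hT' /mxtrace (eq_bigl xpredT); last by move=> uv; rewrite pair_index_lt.
  rewrite -(pair_bigA _ (fun u v : 'I_n => (u == v :> nat)%:Z * (A *m M) u v)) /=.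
  apply: eq_bigr => u _; rewrite (bigD1 u) //= eqxx mul1r big1 ?addr0 // => v ne.
  case: eqP => [e|_]; last by rewrite mul0r.
  by rewrite (val_inj e) eqxx in ne.
Qed.

Lemma faddeevS (A : 'M[int]_n) j u v : let T := A *m faddeev A j in
  faddeev A j.+1 u v = T u v - (u == v :> nat)%:Z * (\tr T %/ j.+1)%Z.
Proof.
by move=> T; rewrite /= -/T; move: (T) => T'; rewrite !mxE mulrb val_eqE; case: (_ == _); rewrite ?mul1r ?mul0r.
Qed.

(** The Euclidean quotient is never larger in absolute value than the trace, so the bound follows
    from the product and the trace alone. *)
Lemma faddeev_le (A : 'M[int]_n) j u v :
  (forall u v, `|A u v| <= X ^ nexps k xs)%N ->
  (`|faddeev A j u v| <= growth ^ j)%N.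
Proof.
move=> hA; elim: j u v => [|j IH] u v.
  by rewrite mxE; case: (_ == _).
rewrite /= -/(faddeev A j); set g := (growth ^ j)%N in IH *; set a := (X ^ _)%N in hA.
set T := A *m _.
have T_le u' v' : (`|T u' v'| <= n * (a * g))%N.
  rewrite mxE -[X in (_ <= X * _)%N](card_ord n); apply: abs_sum_le => w.
  by rewrite abszM leq_mul.
have tr_le : (`|\tr T| <= n * (n * (a * g)))%N.
  by rewrite -[X in (_ <= X * _)%N](card_ord n); apply: abs_sum_le => w.
have d_le := leq_trans (absz_divz_le (\tr T) j.+1) tr_le.
have -> d : (T - d%:M) u v = T u v - (if u == v then d else 0).
  by move: (T) => T'; rewrite !mxE mulrb.
rewrite expnS /growth -/a -/g.
have -> : ((n ^ 3 + n + 1) * a * g = n ^ 3 * (a * g) + n * (a * g) + a * g)%N by ring.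
have n23 : (n * (n * (a * g)) <= n ^ 3 * (a * g))%N.
  have n0 : (0 < n)%N by apply: leq_ltn_trans (ltn_ord u).
  by rewrite mulnA leq_mul2r !expnS expn0 muln1 leq_mul2l leq_pmulr ?orbT.
have tri (y z : int) : (`|y - z| <= `|y| + `|z|)%N by lia.
apply: leq_trans (tri _ _) _.
have := leq_trans d_le n23; have := T_le u v.
set c := if _ then _ else _ => hT hd.
have {hd} : (`|c| <= n ^ 3 * (a * g))%N by rewrite /c; case: (_ == _).
by move=> hc; apply: leq_trans (leq_add hT hc) _; rewrite addnC leq_addr.
Qed.

Lemma faddeev_spec (A : 'M[int]_n) (m : memory) r o :
  (forall u v, `|A u v| <= X ^ nexps k xs)%N -> holds_mx m 1 A ->
  wp faddeev_cmd (keep r o (fun m' =>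
    frame [:: vE; vA; vK; vT; vL] [:: 2%N; 3%N] m m' /\
    holds_mx m' 2 (faddeev A n.-1))) (State m r o).
Proof.
move=> hA mA; pose L := [:: vE; vA; vK; vT; vL]; pose As := [:: 2%N; 3%N].
have lt1 : (1 < 2 ^ b)%N by exact: lt_pow_b (leq_trans (leq_addl _ 1) labels_le).
have fad_lt j u v : (j <= n)%N -> (`|faddeev A j u v| < 2 ^ b)%N.
  by move=> jn; apply: leq_ltn_trans (faddeev_le _ _ _ hA) (growth_exp_lt _); apply: leqW.
apply: (wp_seq_keep (P := fun m' => frame L As m m' /\ holds_mx m' 2 1%:M)).
  apply: (wp_loop (M := (n * n)%N) (J := fun e m' => frame L As m m' /\
     forall uv, (pair_index uv < e)%N -> m' (Posz (4 * pair_index uv + 2)) = (1%:M : 'M[int]_n) uv.1 uv.2)) => //.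
  - by split=> //; fr.
  - by move=> j m' _; apply: val_n2.
  - move=> e m' en hE [fr0 h2]; have [[u v] e_uv] := pair_indexP en.
    have hE' : m' (Negz vE) = pair_index (u, v) by rewrite hE e_uv.
    apply: (wp_store (adr := (4 * pair_index (u, v) + 2)%N) (z := (1%:M : 'M[int]_n) u v)).
    + exact: val_arr.
    + by rewrite (val_delta (val_row hE') (val_col hE')) mxE mulrb -val_eqE /=; case: (_ == _).
    + by rewrite mxE mulrb; case: (u == v) => //; rewrite expn_gt0.
    split=> //=; split; first by rewrite !updE.
    split; first by fr.
    move=> uv; rewrite !updE ltnS leq_eqVlt => /orP [/eqP h|h].
      have -> : uv = (u, v) by apply: pair_index_inj; rewrite h e_uv.
      by rewrite eqxx.
    case: eqP => [h'|_]; first by lia.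
    exact: h2.
  - by move=> m' _ [fr0 h2]; split=> // uv; apply: h2; apply: pair_index_lt.
move=> m1 [fr1 h1].
(* The bound evaluates to the integer n - 1, which is -1 for n = 0, whereas the number of rounds is
   the truncated [n.-1]. *)
apply: (@wp_for_keep _ _ _ _ _ _ n.-1 (n%:Z - 1) (fun j m' => frame L As m m' /\ holds_mx m' 2 (faddeev A j))).
- exact: leq_trans (leq_pred _) n_le.
- exact: lt_pow_b (leq_trans (leq_pred _) n_le).
- by move=> j; rewrite subr_gt0; case: (n) => [|n'] //=; lia.
- split; first by fr.
  by move=> uv; rewrite updE h1.
- by move=> j m' _; apply: val_sub (val_n _) _.
- move=> j m' jn hj [fr0 hM].
  apply: wp_seq; apply: (wp_set (z := 0)) => //; first exact: ltnW.
  apply: wp_seq; apply: wp_keep_weaken.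
    apply: (@product_spec A (faddeev A j) (X ^ nexps k xs) (growth ^ j)); rewrite ?updE //.
    + by move=> u v; apply: faddeev_le.
    + apply: leq_ltn_trans (@growth_exp_lt j.+1 _); last by lia.
      by rewrite [(growth ^ _.+1)%N]expnS mulnA leq_mul // leq_mul // -addnA leq_addr.
    + by move=> uv; rewrite updE fr0.2.
  move=> m2 [fr2 h3 hT]; set T := A *m _ in h3 hT.
  have frm2 : frame L As m' m2.
    apply: frame_trans (frame_sub _ _ fr2); last 2 first.
    - by apply/allP.
    - by apply/allP.
    - by fr.
  have hL2 : m2 (Negz vL) = j by rewrite fr2.1 // updE.
  apply: (wp_loop (M := (n * n)%N) (J := fun e m' => frame [:: vE] [:: 2%N] m2 m' /\
     forall uv, (pair_index uv < e)%N -> m' (Posz (4 * pair_index uv + 2)) = faddeev A j.+1 uv.1 uv.2)) => //.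
  - by split=> //; fr.
  - by move=> ? ? _; apply: val_n2.
  - move=> e m3 en hE [fr3 h2]; have [[u v] e_uv] := pair_indexP en.
    have hE' : m3 (Negz vE) = pair_index (u, v) by rewrite hE e_uv.
    apply: (wp_store (adr := (4 * pair_index (u, v) + 2)%N) (z := faddeev A j.+1 u v)).
    + exact: val_arr.
    + rewrite -[LHS]/(m3 (val m3 (arr 3 (get vE))) - val m3 (deltaE rowE colE) *
         (m3 (Negz vT) %/ (m3 (Negz vL) + 1%:Z))%Z).
      rewrite (val_delta (val_row hE') (val_col hE')) (val_arr 3 (val_get hE')) !fr3.1 // fr3.2 //.
      by rewrite h3 hT hL2 faddeevS -PoszD addn1.
    + by apply: fad_lt; lia.
    split=> //=; split; first by rewrite !updE.
    split; first by fr.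
    move=> uv; rewrite !updE ltnS leq_eqVlt => /orP [/eqP h|h].
      have -> : uv = (u, v) by apply: pair_index_inj; rewrite h e_uv.
      by rewrite eqxx.
    case: eqP => [h'|_]; first by lia.
    exact: h2.
  - move=> m3 _ [fr3 h2]; split; first by rewrite fr3.1.
    split.
      fr; apply: frame_trans fr0 (frame_trans frm2 (frame_sub _ _ fr3)); by apply/allP.
    by move=> uv; rewrite updE h2 ?pair_index_lt.
- by move=> m' _.
Qed.

Definition all_pairs : seq ('I_n * 'I_n) :=
  [seq (u, v) | u <- enum 'I_n, v <- enum 'I_n].

Lemma size_all_pairs : size all_pairs = (n * n)%N.
Proof. by rewrite size_allpairs !size_enum_ord. Qed.

Lemma nth_flatten_const (T : Type) (x0 : T) (ss : seq (seq T)) (d i j : nat) :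
  all (fun s => size s == d) ss -> (j < d)%N ->
  nth x0 (flatten ss) (i * d + j) = nth x0 (nth [::] ss i) j.
Proof.
move=> hs jd; elim: ss i hs => [|s ss IH] i /=; first by rewrite !nth_nil.
move=> /andP [/eqP hs h]; rewrite nth_cat hs; case: i => [|i]; first by rewrite mul0n jd.
by rewrite mulSn -addnA ltnNge leq_addr /= addKn; apply: IH.
Qed.

Lemma nth_all_pairs uv0 uv : nth uv0 all_pairs (pair_index uv) = uv.
Proof.
rewrite /all_pairs /pair_index nth_flatten_const ?ltn_ord //; last first.
  by apply/allP => _ /mapP [u _ ->]; rewrite size_map size_enum_ord.
rewrite (nth_map uv.1) ?size_enum_ord // (nth_map uv.2) ?size_enum_ord //.
by rewrite !nth_ord_enum; case: uv.
Qed.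

(** * Reading the covers off the packed polynomials *)

Section Decode.
Variables (A M : 'M[int]_n).

Definition flag (s : nat) (u v : 'I_n) : bool :=
  unit_flag X (X%:Z ^+ s) (A u v * M v u) == 1.

Definition flag_ok (s : nat) (u : 'I_n) : bool :=
  (\sum_v flag s u v == 1)%N && (\sum_v flag s v u == 1)%N.

Definition flag_valid (s : nat) : bool := [forall u, flag_ok s u].

Definition flag_edges (s : nat) : seq ('I_n * 'I_n) :=
  [seq uv <- all_pairs | flag s uv.1 uv.2].

Definition edge_code (uv : 'I_n * 'I_n) : seq int := [:: (uv.1 : nat)%:Z; (uv.2 : nat)%:Z].

Definition decoded (s : nat) : seq int :=
  if flag_valid s then n%:Z :: flatten (map edge_code (flag_edges s)) else [::].

Lemma X_gt0 : 0 < X%:Z. Proof. by rewrite ltz_nat packing_gt0. Qed.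

Lemma flagE_nat s u v : unit_flag X (X%:Z ^+ s) (A u v * M v u) = flag s u v :> int.
Proof. by rewrite /flag; case: (unit_flag01 (X%:Z ^+ s) (A u v * M v u) X_gt0) => ->. Qed.

Lemma val_flag (m : memory) e f s (u v : 'I_n) :
  m (Negz vX) = X -> m (Negz vP) = (X ^ s)%N -> holds_mx m 1 A -> holds_mx m 2 M ->
  val m e = u -> val m f = v -> val m (flagE e f) = flag s u v.
Proof.
move=> hX hP hA hM he hf; rewrite -flagE_nat.
have h1 := @val_at2 m 1 e f (u, v) _ he hf (hA (u, v)).
have h2 := @val_at2 m 2 f e (v, u) _ hf he (hM (v, u)).
rewrite /flagE; set y := Mul _ _.
have hy : val m y = A u v * M v u.
  by rewrite -[A u v]h1 -[M v u]h2.
move: y hy => y hy; rewrite /unit_flag /= hy hX hP.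
by rewrite -natz natrX natz.
Qed.

Lemma check_spec s (m : memory) r o :
  m (Negz vX) = X -> m (Negz vP) = (X ^ s)%N -> holds_mx m 1 A -> holds_mx m 2 M ->
  wp check_cmd (keep r o (fun m' => frame [:: vB; vU; vA; vT; vV] [::] m m' /\
     m' (Negz vB) = ~~ flag_valid s)) (State m r o).
Proof.
move=> hX hP hA hM; pose L := [:: vB; vU; vA; vT; vV].
have b1 : (1 < 2 ^ b)%N by exact: lt_pow_b (leq_trans (leq_addl _ 1) labels_le).
have b0 : (0 < 2 ^ b)%N by exact: ltnW.
have fl m' (e f : expr) (u v : 'I_n) : frame L [::] m m' -> val m' e = u -> val m' f = v ->
    val m' (flagE e f) = flag s u v.
  move=> fr0; apply: val_flag; rewrite ?fr0.1 //.
    by move=> uv; rewrite fr0.2.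
  by move=> uv; rewrite fr0.2.
apply: wp_seq; apply: (wp_set (z := 0)) => //.
apply: (wp_loop (M := n) (J := fun j m' => frame L [::] m m' /\
  m' (Negz vB) = ~~ [forall u : 'I_n, (u < j)%N ==> flag_ok s u])) => //.
- split; rewrite ?updE; first by fr.
  by rewrite /= (_ : [forall u : 'I_n, _]) //; apply/forallP.
- by move=> j m' _; apply: val_n.
- move=> j m' jn hU [fr0 hB]; pose u := Ordinal jn.
  apply: wp_seq; apply: (wp_set (z := 0)) => //.
  apply: wp_seq; apply: (wp_set (z := 0)) => //.
  pose S1 i := (\sum_(v : 'I_n | (v < i)%N) flag s u v)%N.
  pose S2 i := (\sum_(v : 'I_n | (v < i)%N) flag s v u)%N.
  have S_lt (F : 'I_n -> bool) i : (\sum_(v : 'I_n | (v < i)%N) F v < 2 ^ b)%N.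
    apply: leq_ltn_trans (lt_pow_b n_le); rewrite -[X in (_ <= X)%N]card_ord -sum1_card big_mkcond /=.
    by apply: leq_sum => v _; case: ifP => // _; case: (F v).
  apply: (wp_seq_keep (P := fun m2 => [/\ frame [:: vA; vT; vV] [::] m' m2,
     m2 (Negz vA) = S1 n & m2 (Negz vT) = S2 n])).
    apply: (wp_loop (M := n) (J := fun i m2 => [/\ frame [:: vA; vT; vV] [::] m' m2,
       m2 (Negz vA) = S1 i & m2 (Negz vT) = S2 i])) => //.
    + by split; rewrite ?updE /S1 /S2 ?big_pred0 //; fr.
    + by move=> i m2 _; apply: val_n.
    + move=> i m2 i_n hV [fr2 h1 h2]; pose v := Ordinal i_n.
      have fr02 : frame L [::] m m2.
        by apply: frame_trans fr0 (frame_sub _ _ fr2); [apply/allP|].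
      have hU2 : val m2 (get vU) = u by rewrite /= fr2.1.
      apply: wp_seq; apply: (wp_set (z := S1 i.+1)).
      * rewrite /S1 (partial_sumS _ v (@ord_inj n)); apply: val_add => //.
        exact: fl.
      * exact: S_lt.
      apply: (wp_set (z := S2 i.+1)).
      * rewrite /S2 (partial_sumS _ v (@ord_inj n)); apply: val_add.
          by rewrite /= !updE.
        by apply: fl; rewrite /= ?updE //; fr.
      * exact: (S_lt (fun v => flag s v u)).
      split=> //=; split; rewrite ?updE //; split; rewrite ?updE //; fr.
  move=> m2 [fr2 h1 h2].
  have fr02 : frame L [::] m m2.
    by apply: frame_trans fr0 (frame_sub _ _ fr2); [apply/allP|].
  have okE : flag_ok s u = (S1 n == 1%N) && (S2 n == 1%N).
    have eS (F : 'I_n -> bool) : (\sum_(v : 'I_n | (v < n)%N) F v = \sum_v F v)%N.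
      by apply: eq_bigl => v; rewrite ltn_ord.
    by rewrite /flag_ok /S1 /S2 eS (eS (fun v => flag s v u)).
  have allE : [forall u : 'I_n, (u < j.+1)%N ==> flag_ok s u] =
      [forall u : 'I_n, (u < j)%N ==> flag_ok s u] && flag_ok s u.
    apply/forallP/andP => [h|[/forallP h hu] w].
      split; last by have := h u; rewrite ltnSn.
      by apply/forallP => w; apply/implyP => hw; have := h w; rewrite ltnS ltnW.
    rewrite ltnS leq_eqVlt; apply/implyP => /orP [/eqP e|hw]; last by have := h w; rewrite hw.
    by rewrite (_ : w = u) //; apply: val_inj.
  apply: wp_if_keep; first by rewrite /= h1 h2; reflexivity.
  + move=> pos; apply: (wp_set (z := 1)) => //.
    split=> //=; split; first by rewrite updE fr2.1 ?updE.
    split; first by fr.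
    rewrite !updE /= allE okE; case: eqP pos => [->|_]; case: eqP => [->|_] //; rewrite ?andbF //.
  + move=> neg; split=> //=; split; first by rewrite fr2.1 ?updE.
    split; first by fr.
    rewrite updE /= fr2.1 ?updE // hB allE okE.
    have sq0 (y z : int) : y * y + z * z <= 0 -> y = 0 /\ z = 0 by move=> h; split; nia.
    have [e1 e2] := sq0 _ _ neg.
    have -> : S1 n = 1%N by lia.
    have -> : S2 n = 1%N by lia.
    by rewrite !eqxx !andbT.
- move=> m' _ [fr0 ->]; split=> //; congr (nat_of_bool (~~ _))%:Z.
  by apply: eq_forallb => u; rewrite ltn_ord.
Qed.

Lemma flag_edgesS s uv : [seq ab <- take (pair_index uv).+1 all_pairs | flag s ab.1 ab.2] =
  [seq ab <- take (pair_index uv) all_pairs | flag s ab.1 ab.2] ++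
  (if flag s uv.1 uv.2 then [:: uv] else [::]).
Proof.
rewrite (take_nth uv) ?size_all_pairs ?pair_index_lt // nth_all_pairs.
by rewrite filter_rcons; case: ifP => _; rewrite ?cats0 ?cats1.
Qed.

Lemma print_spec s (m : memory) r o :
  m (Negz vX) = X -> m (Negz vP) = (X ^ s)%N -> holds_mx m 1 A -> holds_mx m 2 M ->
  wp print_cmd (keep r (o ++ n%:Z :: flatten (map edge_code (flag_edges s)))
    (frame [:: vE] [::] m)) (State m r o).
Proof.
move=> hX hP hA hM; apply: wp_seq.
rewrite /wpre -/wp val_n.
pose O j := o ++ n%:Z :: flatten (map edge_code [seq ab <- take j all_pairs | flag s ab.1 ab.2]).
apply: (@wp_for _ _ _ _ _ _ _ _ (n * n)%N (n * n)%N%:Z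
  (fun j => keep r (O j) (frame [:: vE] [::] m))) => //=.
- exact: lt_pow_b.
- by move=> j; rewrite subr_gt0.
- by split=> //=; [rewrite /O take0 cats1|fr].
- by move=> j [m' r' o'] _; apply: val_n2.
- move=> e [m' r' o'] en /= hE [/= -> -> fr0]; have [[u v] e_uv] := pair_indexP en.
  have hE' : m' (Negz vE) = pair_index (u, v) by rewrite hE e_uv.
  have hf : val m' (flagE rowE colE) = flag s u v.
    apply: val_flag (val_row hE') (val_col hE'); rewrite ?fr0.1 // => uv; by rewrite fr0.2.
  have -> : O e.+1 = O e ++ (if flag s u v then edge_code (u, v) else [::]).
    rewrite /O e_uv flag_edgesS map_cat flatten_cat -catA; congr (_ ++ _ :: _ ++ _).
    by case: ifP.
  rewrite /wpre -/wp hf ltz_nat lt0b; case: (flag s u v).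
    rewrite (val_row hE') (val_col hE'); split=> //=; split=> //=; last by fr.
    by rewrite -!cats1 -!catA.
  by split=> //=; split=> //=; rewrite ?cats0 //; fr.
- move=> [m' r' o'] _ [/= -> -> fr0]; split=> //.
  by rewrite /O take_oversize ?size_all_pairs.
Qed.

Lemma decode_spec (m : memory) r o :
  m (Negz vX) = X -> holds_mx m 1 A -> holds_mx m 2 M ->
  wp (decode_cmd k) (keep r (o ++ flatten (map decoded (iota 0 (nexps k xs))))
    (frame [:: vB; vU; vA; vT; vV; vE; vP; vS] [::] m)) (State m r o).
Proof.
move=> hX hA hM; pose L := [:: vB; vU; vA; vT; vV; vE; vP; vS].
apply: wp_seq; apply: (wp_set (z := 1)) => //.
  exact: lt_pow_b (leq_trans (leq_addl _ 1) labels_le).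
pose O j := o ++ flatten (map decoded (iota 0 j)).
apply: (@wp_for _ _ _ _ _ _ _ _ (nexps k xs) (nexps k xs)
  (fun j => keep r (O j)
    (fun m' => frame L [::] m m' /\ m' (Negz vP) = (X ^ j)%N))) => //.
- exact: lt_pow_b.
- by move=> j; rewrite subr_gt0.
- by split=> //=; rewrite /O ?cats0 // !updE; split=> //; fr.
- by move=> j [m' r' o'] _; apply: val_nexps.
- move=> s [m' r' o'] hs /= hS [/= -> -> [fr0 hP]].
  have hX' : m' (Negz vX) = X by rewrite fr0.1.
  have hA' : holds_mx m' 1 A by move=> uv; rewrite fr0.2.
  have hM' : holds_mx m' 2 M by move=> uv; rewrite fr0.2.
  apply: (wp_seq_keep (check_spec _ _ hX' hP hA' hM')) => m2 [fr2 hB].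
  have hX2 : m2 (Negz vX) = X by rewrite fr2.1.
  have hA2 : holds_mx m2 1 A by move=> uv; rewrite fr2.2.
  have hM2 : holds_mx m2 2 M by move=> uv; rewrite fr2.2.
  have hP2 : m2 (Negz vP) = (X ^ s)%N by rewrite fr2.1.
  apply: wp_seq.
  have fr02 : frame L [::] m m2.
    by apply: frame_trans fr0 (frame_sub _ _ fr2); [apply/allP|].
  have -> : O s.+1 = O s ++ decoded s.
    by rewrite /O -addn1 iotaD map_cat flatten_cat /= add0n cats0 catA.
  set o1 := O s.
  have fin m3 : frame L [::] m2 m3 -> m3 (Negz vS) = s -> m3 (Negz vP) = (X ^ s)%N ->
     wp (set_var vP (Mul (get vP) (get vX))) (fun s'' : state =>
       regs s'' (Negz vS) = s /\
       keep r (o1 ++ decoded s) (fun m' => frame L [::] m m' /\ m' (Negz vP) = (X ^ s.+1)%N)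
        {| regs := upd (regs s'') (Negz vS) s.+1; coins := coins s''; output := output s'' |})
       (State m3 r (o1 ++ decoded s)).
    move=> fr3 hS3 hP3; apply: (wp_set (z := (X ^ s.+1)%N)).
    - by rewrite expnSr; apply: val_mul => //=; rewrite fr3.1 // fr2.1 // fr0.1.
    - exact: packing_exp_lt.
    split; rewrite /= ?updE //; split=> //=; rewrite !updE; split=> //.
    by fr; apply: frame_trans fr02 fr3.
  rewrite /wpre -/wp /= hB.
  have := fin; rewrite /decoded; case: (flag_valid s) => fin'.
    apply: wp_weaken (print_spec r o1 hX2 hP2 hA2 hM2) => - [m3 r3 o3] [/= -> -> fr3].
    apply: fin'; rewrite ?fr3.1 //; first by apply: frame_sub fr3; [apply/allP|].
    by rewrite fr2.1.
  by have := fin' m2; rewrite cats0; apply=> //; rewrite fr2.1.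
- by move=> [m' r' o'] _ [/= -> -> [fr0 _]].
Qed.
End Decode.

Definition entry_mx c (rr : nat -> nat) : 'M[int]_n :=
  \matrix_(u, v) (entry k xs c rr (pair_index (u, v)))%:Z.

Definition round_output (rr : nat -> nat) (c : nat) : seq int :=
  flatten (map (decoded (entry_mx c rr) (faddeev (entry_mx c rr) n.-1))
     (iota 0 (nexps k xs))).

Lemma acc_spec r : (n * n * rho <= size r)%N ->
  wp (acc_cmd k) (fun s => output s =
      flatten (map (round_output (fun e => bin_val (block rho r e))) (iota 0 (nscales k xs))))
    (State (fun=> 0) r [::]).
Proof.
move=> hr; set rr := fun e => bin_val _.
apply: (wp_seq_keep (packing_spec _ _ _)) => m0 [_ hX0].
apply: wp_seq; apply: wp_weaken (labels_spec _ _ hr) => - [m1 r' o'] [/= -> -> [fr1 h1]].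
set r1 := drop _ r => {r' o'}.
have rr_lt e : (rr e < 2 * Q + 1)%N.
  apply: leq_trans (bin_val_lt _) _; rewrite size_mkseq; exact: label_bits_exp_le.
pose L := [:: vE; vW; vD; vO; vI; vS; vJ; vP; vA; vK; vT; vL; vB; vU; vV; vC].
(* Array 0 is missing: the labels are drawn once and survive all guesses. *)
pose As := [:: 1%N; 2%N; 3%N].
pose O c := flatten (map (round_output rr) (iota 0 c)).
apply: (@wp_for _ _ _ _ _ _ _ _ (nscales k xs) (nscales k xs)
  (fun c => keep r1 (O c) (frame L As m1))) => //.
- exact: lt_pow_b.
- by move=> j; rewrite subr_gt0.
- by split=> //=; fr.
- by move=> j [m' r' o'] _; apply: val_nscales.
- move=> c [m' r' o'] hc /= hC [/= -> -> fr0].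
  have hX' : m' (Negz vX) = X by rewrite fr0.1 // fr1.1.
  apply: (wp_seq_keep (@entries_spec c rr m' _ _ hc _ hX' hC _)) => //.
    by move=> e en; rewrite fr0.2 // h1.
  move=> m2 [fr2 h2].
  have mA : holds_mx m2 1 (entry_mx c rr).
    by move=> [u v]; rewrite mxE h2 // pair_index_lt.
  have A_le u v : (`|entry_mx c rr u v| <= X ^ nexps k xs)%N.
    rewrite mxE /= /entry; case: ifP => // _; rewrite leq_pexp2l ?packing_gt0 //.
    by apply: ltnW; apply: exponent_lt => //; apply: leq_ltn_trans (ltn_ord u).
  apply: (wp_seq_keep (faddeev_spec _ _ A_le mA)) => m3 [fr3 h3].
  have hX3 : m3 (Negz vX) = X by rewrite fr3.1 // fr2.1.
  have mA3 : holds_mx m3 1 (entry_mx c rr) by move=> uv; rewrite fr3.2.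
  apply: wp_weaken (decode_spec _ _ hX3 mA3 h3) => - [m4 r4 o4] [/= -> -> fr4].
  split; first by rewrite fr4.1 // fr3.1 // fr2.1.
  split=> //=.
    by rewrite /O -[c.+1]addn1 iotaD map_cat flatten_cat /= add0n cats0.
  fr; apply: frame_trans fr0 _.
  apply: frame_trans (frame_sub _ _ fr2) _; [by apply/allP|by apply/allP|].
  apply: frame_trans (frame_sub _ _ fr3) _; [by apply/allP|by apply/allP|].
  by apply: frame_sub fr4; apply/allP.
- by move=> [m' r' o'] _ [/= _ -> _].
Qed.
End Blocks.

(** * The output of a run *)

Lemma exists_digits (d k : nat) (f : nat -> nat) : (forall i, (f i < d)%N) ->
  exists c, (c < d ^ k)%N /\ forall i, (i < k)%N -> (c %/ d ^ i %% d = f i)%N.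
Proof.
move=> fd; elim: k f fd => [|k IH] f fd; first by exists 0%N.
have [c [hc dc]] := IH (fun i => f i.+1) (fun i => fd i.+1).
have d0 : (0 < d)%N by apply: leq_ltn_trans (fd 0%N).
exists (c * d + f 0%N)%N; split.
  rewrite expnSr; apply: (@leq_trans (c.+1 * d)); last by rewrite leq_mul2r hc orbT.
  by rewrite mulSn addnC ltn_add2r.
case=> [_|i ik]; first by rewrite expn0 divn1 modnMDl modn_small.
by rewrite expnS divnMA divnMDl // (divn_small (fd 0%N)) addn0 dc.
Qed.

Lemma sum_bool_eq1 (I : finType) (b : pred I) :
  (\sum_i b i = 1)%N -> exists i0, b =1 pred1 i0.
Proof.
move=> h; have : #|b| == 1%N.
  rewrite -sum1_card big_mkcond -h; apply/eqP/eq_bigr => i _ /=.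
  by rewrite -[i \in b]/(b i); case: (b i).
by move=> /card1P [i0 hi]; exists i0 => i; have := hi i; rewrite inE.
Qed.

Section Correct.
Variables (k : nat) (xs : nat -> nat).
Local Notation n := (xs 2%N).
Variable E : {set 'I_n * 'I_n}.
Hypothesis edge_bitP : forall uv, edge_bit k xs (pair_index uv) = (uv \in E).

Section Flags.
Variables (A M : 'M[int]_n) (s : nat).
Hypothesis A_support : forall u v, A u v != 0 -> (u, v) \in E.

Lemma mem_all_pairs uv : uv \in all_pairs xs.
Proof. by case: uv => u v; apply/allpairsP; exists (u, v); rewrite !mem_enum. Qed.

Lemma uniq_all_pairs : uniq (all_pairs xs).
Proof. by apply: allpairs_uniq; rewrite ?enum_uniq // => - [? ?] [? ?]. Qed.

(** For a non-edge the factor [A u v] vanishes and the product packs the zero polynomial, whatever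
    the labels are. *)
Lemma flag_support u v : flag A M s u v -> (u, v) \in E.
Proof.
move=> h; apply: A_support; apply: contraTneq h => A0.
by rewrite /flag A0 mul0r unit_flag0 // ?exprn_gt0 // ltz_nat packing_gt0.
Qed.

Lemma size_flag_edges : flag_valid A M s -> size (flag_edges A M s) = n.
Proof.
move=> /forallP h; rewrite size_filter -sum1_count big_mkcond big_allpairs /=.
rewrite big_enum /= -[RHS](card_ord n) -sum1_card; apply: eq_bigr => u _.
have /andP [/eqP h1 _] := h u; rewrite -[RHS]h1 big_enum /=; apply: eq_bigr => v _.
by case: (flag _ _ _ _ _).
Qed.

(** A 0/1 matrix with all row and column sums 1 is a permutation matrix: the rows give a map, and
    the columns give its left inverse. *)
Lemma flag_validP : flag_valid A M s ->
  exists sg : {perm 'I_n}, forall u v, flag A M s u v = (sg u == v).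
Proof.
move=> /forallP h.
have row u : exists v0, flag A M s u =1 pred1 v0.
  by have /andP [/eqP /sum_bool_eq1] := h u.
have col v : exists u0, (fun u => flag A M s u v) =1 pred1 u0.
  by have /andP [_ /eqP /(sum_bool_eq1 (b := fun u => flag A M s u v))] := h v.
have [f hf] := fin_all_exists row; have [g hg] := fin_all_exists col.
have f_inj : injective f.
  have fg u : g (f u) = u.
    by apply/esym/eqP; rewrite -[_ == _]/(pred1 (g (f u)) u) -hg hf /= eqxx.
  exact: can_inj fg.
by exists (perm f_inj) => u v; rewrite permE hf /= eq_sym.
Qed.

Lemma flag_edges_set (sg : {perm 'I_n}) : (forall u v, flag A M s u v = (sg u == v)) ->
  [set:: flag_edges A M s] = perm_edges sg.
Proof.
move=> h; apply/setP => - [u v].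
by rewrite inE mem_filter mem_all_pairs andbT h mem_perm_edges.
Qed.

Lemma flags_of_perm (sg : {perm 'I_n}) : (forall u v, flag A M s u v = (sg u == v)) ->
  flag_valid A M s.
Proof.
move=> h; apply/forallP => u; apply/andP; split; apply/eqP.
  rewrite (bigD1 (sg u)) //= h eqxx big1 ?addn0 // => v.
  by rewrite h eq_sym => /negPf ->.
rewrite (bigD1 (sg^-1%g u)) //= h permKV eqxx big1 ?addn0 // => v.
rewrite h => ne; case: eqP => // e.
by rewrite -e permK eqxx in ne.
Qed.

Lemma decodedE : decoded A M s =
  if flag_valid A M s then encode_edge_list (flag_edges A M s) else [::].
Proof.
by rewrite /decoded; case: ifP => // h; rewrite /encode_edge_list size_flag_edges.
Qed.

Lemma flag_edges_cover : flag_valid A M s ->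
  is_cycle_cover E [set:: flag_edges A M s].
Proof.
move=> h; have [sg hsg] := flag_validP h; rewrite (flag_edges_set hsg).
apply: perm_cycle_cover; apply/subsetP => - [u v].
by rewrite mem_perm_edges -hsg => /flag_support.
Qed.
End Flags.

Section Rounds.
Variable rr : nat -> nat.

Lemma entry_mx_support c u v : entry_mx k xs c rr u v != 0 -> (u, v) \in E.
Proof.
by rewrite mxE /entry edge_bitP; case: (_ \in E).
Qed.

Definition round_valid (c s : nat) : bool :=
  let A := entry_mx k xs c rr in flag_valid A (faddeev A n.-1) s.

Definition round_edges (c s : nat) : seq ('I_n * 'I_n) :=
  let A := entry_mx k xs c rr in flag_edges A (faddeev A n.-1) s.

Definition outputs : seq (seq ('I_n * 'I_n)) :=
  [seq round_edges c s | c <- iota 0 (nscales k xs),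
     s <- [seq s <- iota 0 (nexps k xs) | round_valid c s]].

Lemma outputs_code :
  flatten (map (round_output k xs rr) (iota 0 (nscales k xs))) =
  flatten (map (@encode_edge_list n) outputs).
Proof.
rewrite /outputs map_allpairs; elim: (iota 0 _) => //= c l ->; rewrite flatten_cat.
congr (_ ++ _); rewrite /round_output; elim: (iota 0 _) => //= s l' ->.
by rewrite decodedE -/(round_valid c s); case: ifP.
Qed.

Lemma mem_outputs l : l \in outputs -> exists c s,
  [/\ (c < nscales k xs)%N, round_valid c s & l = round_edges c s].
Proof.
move=> /allpairsPdep [c [s [hc]]]; rewrite mem_filter => /andP [hv _] ->.
by exists c, s; rewrite mem_iota add0n in hc.
Qed.

Lemma outputs_encode : encodes_family
  (flatten (map (round_output k xs rr) (iota 0 (nscales k xs))))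
  [set:: [seq [set:: l] | l <- outputs]].
Proof.
exists outputs; split=> //; last exact: outputs_code.
apply/allP => l /mem_outputs [c [s [_ _ ->]]].
by rewrite filter_uniq ?uniq_all_pairs.
Qed.

(** Holds for every labelling [rr]: a bad draw may lose covers but prints nothing infeasible. *)
Lemma outputs_feasible y :
  y \in [set:: [seq [set:: l] | l <- outputs]] -> is_cycle_cover E y.
Proof.
rewrite inE => /mapP [l /mem_outputs [c [s [_ hv ->]]] ->].
by apply: flag_edges_cover => // u v; apply: entry_mx_support.
Qed.

Lemma outputs_mem c s (sg : {perm 'I_n}) : (c < nscales k xs)%N -> (s < nexps k xs)%N ->
  (forall u v, let A := entry_mx k xs c rr in
     flag A (faddeev A n.-1) s u v = (sg u == v)) ->
  perm_edges sg \in [set:: [seq [set:: l] | l <- outputs]].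
Proof.
move=> hc hs h; rewrite inE; apply/mapP; exists (round_edges c s); last first.
  by rewrite (flag_edges_set h).
apply/allpairsPdep; exists c, s; rewrite mem_filter !mem_iota !add0n hc hs !andbT.
by split=> //; apply: (@flags_of_perm _ _ s sg).
Qed.
End Rounds.
End Correct.

(** * Isolation and approximation *)

Section Classes.
Variables (k : nat) (xs : nat -> nat).
Local Notation p := (xs 0%N).
Local Notation q := (xs 1%N).
Local Notation n := (xs 2%N).
Local Notation X := (packing xs).
Local Notation Q := (min_labels k xs).
Local Notation rho := (up_log 2 Q).

Definition arc (sg : 'S_n) (u : 'I_n) : nat := pair_index (u, sg u).

Definition light_perm (c : nat) (sg : 'S_n) : bool :=
  [forall u, (0 < edge_bit k xs (arc sg u))%N && light k xs c (arc sg u) k].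

Definition perm_profile (c : nat) (sg : 'S_n) (j : nat) : nat :=
  (\sum_u profile k xs c (arc sg u) j)%N.

Definition perm_scaled (c : nat) (sg : 'S_n) (i : nat) : nat :=
  (\sum_u scaled_wt k xs c (arc sg u) i)%N.

Definition perm_label (rr : nat -> nat) (sg : 'S_n) : nat :=
  (\sum_u rr (arc sg u))%N.

Lemma light_scaled c e i : light k xs c e k -> (i < k)%N ->
  (scaled_wt k xs c e i <= cap xs)%N.
Proof. by move=> /allP h ik; apply: h; rewrite mem_iota. Qed.

Lemma perm_profileS c sg j : light_perm c sg -> (j < k)%N ->
  perm_profile c sg j.+1 = (perm_profile c sg j * radix xs + perm_scaled c sg j)%N.
Proof.
move=> /forallP h jk; rewrite /perm_profile /perm_scaled big_distrl -big_split /=.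
apply: eq_bigr => u _; have /andP [_ l] := h u.
by rewrite (light_scaled l jk).
Qed.

Lemma perm_scaled_lt c sg i : light_perm c sg -> (i < k)%N ->
  (perm_scaled c sg i < radix xs)%N.
Proof.
move=> /forallP h ik; rewrite /radix addn1 ltnS -[X in (_ <= X * _)%N](card_ord n).
rewrite -sum_nat_const; apply: leq_sum => u _.
by have /andP [_ l] := h u; apply: light_scaled.
Qed.

Lemma perm_profile_lt c sg j : light_perm c sg -> (j <= k)%N ->
  (perm_profile c sg j < radix xs ^ j)%N.
Proof.
move=> h; elim: j => [|j IH] jk; first by rewrite /perm_profile big1.
rewrite perm_profileS // expnSr; have := IH (ltnW jk); have := perm_scaled_lt h jk.
move: (perm_profile _ _ _) (perm_scaled _ _ _) => y z hz hy.
apply: (@leq_trans (y.+1 * radix xs)); last by rewrite leq_mul2r hy orbT.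
by rewrite mulSn addnC ltn_add2r.
Qed.

(** For light covers the profile is a base-[radix] numeral whose digits, the scaled weights of the
    cover, stay below the base; quotient and remainder recover them. *)
Lemma perm_profile_inj c sg sg' j : light_perm c sg -> light_perm c sg' ->
  (j <= k)%N -> perm_profile c sg j = perm_profile c sg' j ->
  forall i, (i < j)%N -> perm_scaled c sg i = perm_scaled c sg' i.
Proof.
move=> h h'; elim: j => // j IH jk; rewrite !perm_profileS // => e i.
have l1 := perm_scaled_lt h jk; have l2 := perm_scaled_lt h' jk.
have r0 : (0 < radix xs)%N by rewrite /radix addn1.
rewrite ltnS leq_eqVlt => /orP [/eqP ->|].
  by have := congr1 (modn^~ (radix xs)) e; rewrite !modnMDl !modn_small.
apply: IH; first exact: ltnW.
by have := congr1 (divn^~ (radix xs)) e; rewrite !divnMDl // !divn_small // !addn0.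
Qed.

Definition perm_exponent (c : nat) (rr : nat -> nat) (sg : 'S_n) : nat :=
  (perm_profile c sg k * shift k xs + perm_label rr sg)%N.

Lemma prod_entry_mx c rr (sg : 'S_n) :
  \prod_u entry_mx k xs c rr u (sg u) =
  if light_perm c sg then X%:Z ^+ perm_exponent c rr sg else 0.
Proof.
case: ifP => [/forallP h|/negbT].
  rewrite /perm_exponent /perm_profile /perm_label big_distrl -big_split /= expr_sum.
  apply: eq_bigr => u _; rewrite mxE /entry -/(arc sg u) h /exponent.
  by rewrite -natz natrX natz.
rewrite negb_forall => /existsP [u hu].
by rewrite (bigD1 u) //= mxE /entry -/(arc sg u) (negPf hu) mul0r.
Qed.

Lemma card_perm_packing : (#|{: 'S_n}|.*2%:Z < X%:Z).
Proof.
rewrite ltz_nat /packing addn1 ltnS -mul2n leq_mul2l /=.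
have inj : injective (fun s : 'S_n => [ffun u => s u]).
  by move=> s s' /ffunP h; apply/permP => u; have := h u; rewrite !ffunE.
by have := leq_card _ inj; rewrite card_ffun card_ord.
Qed.

Lemma perm_label_lt rr sg : (forall e, (rr e < 2 * Q + 1)%N) ->
  (perm_label rr sg < shift k xs)%N.
Proof.
move=> h; rewrite /shift addn1 ltnS mulnAC -(mulnA 2) -[X in (_ <= 2 * (_ * X))%N](card_ord n).
rewrite mulnA mulnC -sum_nat_const; apply: leq_sum => u _.
by have := h (arc sg u); rewrite addn1 ltnS.
Qed.

Lemma perm_exponent_lt c rr sg : light_perm c sg ->
  (forall e, (rr e < 2 * Q + 1)%N) -> (perm_exponent c rr sg < nexps k xs)%N.
Proof.
move=> l /perm_label_lt -/(_ sg) h1; have := perm_profile_lt l (leqnn k).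
rewrite -/(nprofiles k xs) /perm_exponent /nexps => h2.
apply: (@leq_trans ((perm_profile c sg k).+1 * shift k xs)); last by rewrite leq_mul2r h2 orbT.
by rewrite mulSn addnC ltn_add2r.
Qed.

(** Minimality of the label within the profile class and uniqueness of the minimum, merged into one
    clause. *)
Definition lightest (c : nat) (rr : nat -> nat) (sg : 'S_n) : Prop :=
  light_perm c sg /\ forall sg', light_perm c sg' ->
    perm_profile c sg' k = perm_profile c sg k ->
    (perm_label rr sg' <= perm_label rr sg)%N -> sg' = sg.

(** Labels of covers stay below [shift], so equal exponents mean equal profiles and equal labels.
    Only [sg] can contribute to its exponent: the coefficient is 1 or -1 if it uses (u, v), and 0
    otherwise. *)
Lemma lightest_flag c rr sg u v : (forall e, (rr e < 2 * Q + 1)%N) ->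
  lightest c rr sg -> let A := entry_mx k xs c rr in
  flag A (faddeev A n.-1) (perm_exponent c rr sg) u v = (sg u == v).
Proof.
move=> hrr [l uniq_sg] A.
have [b hb] := mul_faddeev A u v.
rewrite /flag hb; under eq_bigr => s _ do rewrite prod_entry_mx.
have -> : \sum_(s : 'S_n | s u == v) (-1) ^+ b s *
    (if light_perm c s then X%:Z ^+ perm_exponent c rr s else 0) =
    \sum_(s : 'S_n | (s u == v) && light_perm c s) (-1) ^+ b s * X%:Z ^+ perm_exponent c rr s.
  by rewrite [RHS]big_mkcondr; apply: eq_bigr => s _; case: ifP; rewrite ?mulr0.
rewrite unit_flag_sum; last exact: card_perm_packing.
have only s : light_perm c s -> (perm_exponent c rr s == perm_exponent c rr sg) = (s == sg).
  move=> ls; apply/eqP/eqP => [e|->] //.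
  have h1 := perm_label_lt s hrr; have h2 := perm_label_lt sg hrr.
  have s0 : (0 < shift k xs)%N by apply: leq_ltn_trans h1.
  apply: uniq_sg => //.
    by have := congr1 (divn^~ (shift k xs)) e; rewrite /perm_exponent !divnMDl // !divn_small // !addn0.
  by have := congr1 (modn^~ (shift k xs)) e; rewrite /perm_exponent !modnMDl !modn_small // => ->.
rewrite (eq_bigl (fun s : 'S_n => (s u == v) && (s == sg))); last first.
  move=> s; rewrite -andbA; case ls : (light_perm c s) => /=; first by rewrite only.
  by case: (s =P sg) => [e|]; rewrite ?andbF //; rewrite -e ls in l.
case: (sg u =P v) => [e|ne].
  rewrite (big_pred1 sg); last by move=> s /=; case: (s =P sg) => [->|_]; rewrite ?e ?eqxx ?andbF.
  by rewrite signr_eq0.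
by rewrite big_pred0 // => s; case: (s =P sg) => [->|_]; rewrite ?andbF // andbT; apply/eqP.
Qed.

Definition arc_ord (sg : 'S_n) (u : 'I_n) : 'I_(n * n) :=
  Ordinal (pair_index_lt (u, sg u)).

Definition arc_set (sg : 'S_n) : {set 'I_(n * n)} := [set arc_ord sg u | u : 'I_n].

Lemma arc_ord_inj sg : injective (arc_ord sg).
Proof. by move=> u v /(congr1 val) /= /pair_index_inj []. Qed.

Lemma arc_set_inj : injective arc_set.
Proof.
move=> s s' h; apply/permP => u.
have : arc_ord s u \in arc_set s' by rewrite -h; apply/imsetP; exists u.
by case/imsetP => v _ /(congr1 val) /= /pair_index_inj [-> ->].
Qed.

Definition family (c W : nat) : {set {set 'I_(n * n)}} :=
  [set arc_set sg | sg in [pred sg | light_perm c sg && (perm_profile c sg k == W)]].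

(** * Union bound for the random labels *)

Section Draw.
Variable t : nat.
Hypothesis t_ge : (n * n * rho <= t)%N.

Definition labels_of (r : seq bool) (e : nat) : nat := bin_val (block rho r e).

Definition isolates (r : t.-tuple bool) (c W : nat) : bool :=
  isolated (fun b : rho.-tuple bool => bin_val b) (@block_tuple t (n * n) rho)
    (family c W) r.

Definition good_draw (r : t.-tuple bool) : bool :=
  [forall c : 'I_(nscales k xs), [forall W : 'I_(nprofiles k xs), isolates r c W]].

(** Union bound over all pairs of a guess and a profile for one common draw, cleared of denominators
    by the factor 2^rho. *)
Lemma card_bad_draw : (2 * #|[set r | ~~ good_draw r]| <= 2 ^ t)%N.
Proof.
have rho0 : (0 < 2 ^ rho)%N by rewrite expn_gt0.
rewrite -(leq_pmul2r rho0).
have sub : [set r | ~~ good_draw r] \subset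
    \bigcup_(cW : 'I_(nscales k xs) * 'I_(nprofiles k xs)) [set r | ~~ isolates r cW.1 cW.2].
  apply/subsetP => r; rewrite inE negb_forall => /existsP [c].
  by rewrite negb_forall => /existsP [W h]; apply/bigcupP; exists (c, W); rewrite ?inE.
have le1 : (#|[set r | ~~ good_draw r]| * 2 ^ rho <=
    nscales k xs * nprofiles k xs * (n * n * 2 ^ t))%N.
  apply: leq_trans (leq_mul (subset_leq_card sub) (leqnn _)) _.
  apply: leq_trans (leq_mul (_ : _ <= \sum_(cW : 'I_(nscales k xs) * 'I_(nprofiles k xs))
    #|[set r | ~~ isolates r cW.1 cW.2]|)%N (leqnn _)) _.
    elim/big_ind2: _ => [|A a B b hA hB|//]; first by rewrite cards0.
    by apply: leq_trans (leq_add hA hB); rewrite cardsU leq_subr.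
  rewrite big_distrl /= -[X in (_ <= X * _ * _)%N](card_ord (nscales k xs)).
  rewrite -[X in (_ <= _ * X * _)%N](card_ord (nprofiles k xs)) -card_prod -sum_nat_const.
  by apply: leq_sum => cW _; apply: card_not_isolated_blocks t_ge _.
rewrite -mulnA; apply: leq_trans (leq_mul (leqnn 2) le1) _.
have := up_logP Q (isT : 1 < 2)%N; rewrite -(leq_pmul2l (expn_gt0 2 t : 0 < 2 ^ t)%N).
by apply: leq_trans; rewrite /min_labels; apply: eq_leq; ring.
Qed.

Lemma label_weight_arc_set (r : t.-tuple bool) sg :
  label_weight (fun b : rho.-tuple bool => bin_val b) (@block_tuple t (n * n) rho) r (arc_set sg)
  = perm_label (labels_of r) sg.
Proof.
rewrite /label_weight big_imset /=; last by move=> u v _ _; apply: arc_ord_inj.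
by apply: eq_bigr => u _; rewrite /labels_of -[arc sg u]/(val (arc_ord sg u)) (block_tupleE rho r).
Qed.

(** The class of [sg0] is nonempty, so a member of least label exists; isolation makes it the only
    one. *)
Lemma good_lightest (r : t.-tuple bool) c sg0 :
  good_draw r -> (c < nscales k xs)%N -> light_perm c sg0 ->
  exists2 sg, lightest c (labels_of r) sg & perm_profile c sg k = perm_profile c sg0 k.
Proof.
move=> hg hc l0; set W := perm_profile c sg0 k.
have hW : (W < nprofiles k xs)%N by apply: perm_profile_lt.
pose P := [pred sg : 'S_n | light_perm c sg && (perm_profile c sg k == W)].
have P0 : P sg0 by rewrite inE l0 eqxx.
case: (arg_minnP (perm_label (labels_of r)) P0) => sg /andP [l /eqP pW] min_sg.
exists sg => //; split=> // sg' l' p' le'.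
have /forallP /(_ (Ordinal hc)) /forallP /(_ (Ordinal hW)) iso := hg.
apply/esym/arc_set_inj/eqP.
have min s : P s -> (perm_label (labels_of r) s <= perm_label (labels_of r) sg)%N ->
    minimal (fun b : rho.-tuple bool => bin_val b) (@block_tuple t (n * n) rho) (family c W) r (arc_set s).
  move=> Ps le_s; apply/andP; split; first by apply/imsetP; exists s.
  apply/forall_inP => _ /imsetP [s2 P2 ->]; rewrite !label_weight_arc_set.
  exact: leq_trans le_s (min_sg _ P2).
have /forallP /(_ (arc_set sg)) /forallP /(_ (arc_set sg')) /implyP := iso; apply.
by rewrite !min //= ?l' ?p' ?l ?pW ?eqxx.
Qed.
End Draw.

(** * Scaling loses at most a factor 1 + eps *)

Section Approximation.
Variables (E : {set 'I_n * 'I_n}) (w : 'I_k -> 'I_n * 'I_n -> nat).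
Hypothesis p_gt0 : (0 < p)%N.
Hypothesis q_gt0 : (0 < q)%N.
Hypothesis edge_bitP : forall uv, edge_bit k xs (pair_index uv) = (uv \in E).
Hypothesis edge_wtP : forall uv (i : 'I_k), uv \in E ->
  edge_wt k xs (pair_index uv) i = w i uv.

(* The guess is the heaviest edge of the cycle cover for each objective, so
   that scaling loses at most (p / q) times the weight of that edge. *)
Lemma exists_scale (sz : 'S_n) : perm_edges sz \subset E ->
  exists c, [/\ (c < nscales k xs)%N, light_perm c sz &
    forall sg : 'S_n, light_perm c sg -> perm_profile c sg k = perm_profile c sz k ->
    forall i : 'I_k, (q * (\sum_u w i (u, sg u)) <= (q + p) * (\sum_u w i (u, sz u)))%N].
Proof.
move=> sub.
have inE' u : (u, sz u) \in E by apply: (subsetP sub); rewrite mem_perm_edges.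
have heaviest (i : 'I_k) : exists e : nat, (e < digit_base xs)%N /\
    forall u, (w i (u, sz u) <= edge_wt k xs e i)%N /\
      (edge_wt k xs e i <= \sum_u w i (u, sz u))%N.
  case: (pickP (@predT 'I_n)) => [u0 _|no]; last first.
    by exists 0%N; split=> [|u]; [rewrite /digit_base addn1|have := no u].
  case: (arg_maxnP (fun u => w i (u, sz u)) (erefl true : xpredT u0)) => u _ hu.
  exists (arc sz u); split; first by rewrite /digit_base addn1 ltnS ltnW // pair_index_lt.
  by move=> v; rewrite edge_wtP //; split; [exact: (hu v isT)|rewrite (bigD1 u) //= leq_addr].
have [f hf] := fin_all_exists heaviest.
pose g i := if insub i is Some j then f j else 0%N.
have g_lt i : (g i < digit_base xs)%N.
  rewrite /g; case: insubP => [j _ _|_]; first by case: (hf j).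
  by rewrite /digit_base addn1.
have [c [hc dc]] := exists_digits k g_lt.
have cE (i : 'I_k) : (c %/ digit_base xs ^ i %% digit_base xs = f i)%N.
  by rewrite dc // /g valK.
(* With m the guessed weight and D its scale, m p < D n q and (wu / D) D <= wu <= m. Multiplying and
   cancelling m gives (wu / D) p <= n q, which is within the cap. *)
have lz : light_perm c sz.
  apply/forallP => u; rewrite edge_bitP inE' /=; apply/allP => i0; rewrite mem_iota add0n => ik.
  pose i := Ordinal ik; have [_ /(_ u) [h1 h2]] := hf i.
  rewrite -[i0]/(nat_of_ord i) /cap leq_divRL // /scaled_wt /scale cE edge_wtP //.
  set m := edge_wt k xs (f i) i in h1 h2 *; set wu := w i (u, sz u) in h1 *.
  have n0 : (0 < n)%N by apply: leq_ltn_trans (ltn_ord u).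
  have nq0 : (0 < n * q)%N by rewrite muln_gt0 n0.
  set D := (m * p %/ (n * q) + 1)%N.
  have hD : (m * p < D * (n * q))%N by rewrite /D addn1 ltn_ceil.
  have hw := leq_trans (leq_trunc_div wu D) h1.
  case: (posnP m) => [m0|m0]; first by move: hw; rewrite m0 leqn0 /D addn1 muln_eq0 orbF => /eqP ->.
  rewrite -(leq_pmul2l m0).
  apply: (@leq_trans (m * (n * q))).
    apply: (@leq_trans (wu %/ D * D * (n * q))); last by rewrite leq_mul2r hw orbT.
    by rewrite mulnCA -mulnA leq_mul2l ltnW ?orbT.
  by rewrite leq_mul2l -mulnA leq_pmull ?orbT.
exists c; split=> // sg l pe i.
have ds := perm_profile_inj l lz (leqnn k) pe (ltn_ord i).
case: (posnP n) => [n0|n0].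
  rewrite big_pred0 ?muln0 // => u; have := leq_trans (ltn_ord u) (eq_leq n0).
  by [].
have [_ /(_ (Ordinal n0)) [_ hm]] := hf i.
pose D := scale k xs c i; have D0 : (0 < D)%N by rewrite /D /scale addn1.
have wtE s u : light_perm c s -> w i (u, s u) = edge_wt k xs (arc s u) i.
  move=> /forallP /(_ u) /andP [h _]; rewrite -edge_wtP //.
  by move: h; rewrite edge_bitP; case: (_ \in E).
(* Rounding down to a multiple of D costs at most D - 1 on each of the n edges. *)
have up : (\sum_u w i (u, sg u) <= perm_scaled c sg i * D + n * D.-1)%N.
  rewrite /perm_scaled big_distrl -[X in (_ <= _ + X * _)%N](card_ord n) -sum_nat_const -big_split /=.
  apply: leq_sum => u _; rewrite (wtE _ _ l) /scaled_wt -/D.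
  by have := ltn_ceil (edge_wt k xs (arc sg u) i) D0; rewrite mulSn; lia.
have lo : (perm_scaled c sz i * D <= \sum_u w i (u, sz u))%N.
  rewrite /perm_scaled big_distrl /=; apply: leq_sum => u _; rewrite (wtE _ _ lz).
  exact: leq_trunc_div.
(* D - 1 is m p / (n q) rounded down, so the total loss times q is at most m p, and m is at most the
   weight of the cover. *)
have loss : (q * (n * D.-1) <= p * \sum_u w i (u, sz u))%N.
  rewrite /D /scale addn1 /= cE mulnCA mulnA mulnC; apply: leq_trans (leq_trunc_div _ _) _.
  by rewrite mulnC leq_mul2l hm orbT.
apply: leq_trans (leq_mul (leqnn q) up) _; rewrite mulnDr mulnDl leq_add //.
by rewrite ds leq_mul2l lo orbT.
Qed.
End Approximation.
End Classes.

(** * Polynomial bounds *)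

Section PolyBounded.
Variables (I : Type) (m : I -> nat).
Hypothesis m_gt0 : forall z, (0 < m z)%N.

Definition poly_bounded (f : I -> nat) : Prop :=
  exists c d, forall z, (f z <= c * m z ^ d)%N.

Lemma poly_bounded_le f g : (forall z, (f z <= g z)%N) ->
  poly_bounded g -> poly_bounded f.
Proof. by move=> h [c [d hg]]; exists c, d => z; apply: leq_trans (h z) (hg z). Qed.

Lemma poly_bounded_const c : poly_bounded (fun=> c).
Proof. by exists c, 0%N => z; rewrite expn0 muln1. Qed.

Lemma poly_bounded_measure : poly_bounded m.
Proof. by exists 1%N, 1%N => z; rewrite mul1n expn1. Qed.

Lemma poly_bounded_add f g : poly_bounded f -> poly_bounded g ->
  poly_bounded (fun z => f z + g z)%N.
Proof.
move=> [c [d hf]] [c' [d' hg]]; exists (c + c')%N, (d + d')%N => z.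
rewrite mulnDl; apply: leq_add.
  by apply: leq_trans (hf z) _; rewrite leq_mul2l leq_pexp2l ?leq_addr ?orbT.
by apply: leq_trans (hg z) _; rewrite leq_mul2l leq_pexp2l ?leq_addl ?orbT.
Qed.

Lemma poly_bounded_mul f g : poly_bounded f -> poly_bounded g ->
  poly_bounded (fun z => f z * g z)%N.
Proof.
move=> [c [d hf]] [c' [d' hg]]; exists (c * c')%N, (d + d')%N => z.
by rewrite expnD mulnACA; apply: leq_mul.
Qed.

Lemma poly_bounded_exp f j : poly_bounded f -> poly_bounded (fun z => f z ^ j)%N.
Proof.
move=> hf; elim: j => [|j IH].
  by apply: poly_bounded_le (poly_bounded_const 1) => z; rewrite expn0.
by apply: poly_bounded_le (poly_bounded_mul hf IH) => z; rewrite expnS.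
Qed.

Lemma poly_bounded_cost (N : I -> nat) c : poly_bounded N ->
  poly_bounded (fun z => cmd_cost (N z) c).
Proof.
move=> hN; elim: c => /= [|a e|a|e|c1 h1 c2 h2|e c1 h1 c2 h2|e c h];
  try exact: poly_bounded_const.
- exact: poly_bounded_add.
- apply: poly_bounded_add h2; apply: poly_bounded_add h1; exact: poly_bounded_const.
- apply: poly_bounded_mul.
    apply: poly_bounded_le (poly_bounded_add hN (poly_bounded_const 1)) => z; by rewrite addn1.
  by apply: poly_bounded_add h; apply: poly_bounded_const.
Qed.
End PolyBounded.

(** * Rounds, word size and cost of a run *)

Section Resources.
Variable k : nat.

Definition rounds (xs : nat -> nat) : nat :=
  (nexps k xs + nscales k xs + xs 2 * xs 2 + xs 2 + k + (2 * min_labels k xs + 1))%N.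

Definition word_size (xs : nat -> nat) (sz : nat) : nat :=
  ((xs 2 + 1) * (3 * xs 2 + 2 + (xs 2 * xs 2 + 2) * nexps k xs) + 1 + rounds xs + sz)%N.

(** This number also serves as the number of supplied coins; the second summand makes it large
    enough for n^2 labels of rho bits. *)
Definition run_cost (xs : nat -> nat) (sz : nat) : nat :=
  (cmd_cost (rounds xs) (acc_cmd k) * word_size xs sz + xs 2 * xs 2 * rounds xs)%N.

(** [cap] is the only place where 1/eps enters; all other parameters are polynomials in n and [cap],
    because the exponent [k] is fixed. *)
Definition measure (z : (nat -> nat) * nat) : nat := (z.1 2 + cap z.1 + z.2 + 1)%N.

Ltac pb m0 := repeat first
  [ eassumption | exact: poly_bounded_const | apply: (poly_bounded_add m0)
  | apply: poly_bounded_mul | apply: poly_bounded_exp ].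

Lemma run_cost_poly : poly_bounded measure (fun z => run_cost z.1 z.2).
Proof.
have m0 z : (0 < measure z)%N by rewrite /measure addn1.
have low f : (forall z, (f z <= measure z)%N) -> poly_bounded measure f.
  by move=> h; apply: poly_bounded_le h (poly_bounded_measure _).
have hn : poly_bounded measure (fun z => z.1 2) by apply: low => z; rewrite /measure -!addnA leq_addr.
have hc : poly_bounded measure (fun z => cap z.1).
  by apply: low => z; rewrite /measure [(z.1 2 + _)%N]addnC -!addnA leq_addr.
have hs : poly_bounded measure (fun z => z.2).
  by apply: low => z; rewrite /measure [(_ + z.2)%N]addnC -!addnA leq_addr.
have hb : poly_bounded measure (fun z => nscales k z.1) by rewrite /nscales /digit_base ; pb m0.
have hp : poly_bounded measure (fun z => nprofiles k z.1) by rewrite /nprofiles /radix ; pb m0.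
have hl : poly_bounded measure (fun z => min_labels k z.1) by rewrite /min_labels ; pb m0.
have hh : poly_bounded measure (fun z => shift k z.1) by rewrite /shift ; pb m0.
have hx : poly_bounded measure (fun z => nexps k z.1) by rewrite /nexps ; pb m0.
have hr : poly_bounded measure (fun z => rounds z.1) by rewrite /rounds ; pb m0.
have hw : poly_bounded measure (fun z => word_size z.1 z.2) by rewrite /word_size ; pb m0.
have hq := poly_bounded_cost m0 (acc_cmd k) hr.
rewrite /run_cost; apply: (poly_bounded_add m0); first exact: poly_bounded_mul hq hw.
by pb m0.
Qed.

(** From n <= 2^n follow n^3 + n + 1 <= 2^(3n+2) and X <= 2^(n^2+2), the exponents that appear in
    [word_size]. *)
Lemma growth_lt xs sz : (growth k xs ^ (xs 2).+1 < 2 ^ word_size xs sz)%N.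
Proof.
set n := xs 2%N.
have n2 : (n <= 2 ^ n)%N by apply: ltnW; apply: ltn_expl.
have h1 : (n ^ 3 + n + 1 <= 2 ^ (3 * n + 2))%N.
  have h3 : (n ^ 3 <= 2 ^ (3 * n))%N by rewrite mulnC expnM leq_exp2r.
  have h4 : (n <= 2 ^ (3 * n))%N by apply: leq_trans n2 _; rewrite leq_exp2l // leq_pmull.
  have h5 : (0 < 2 ^ (3 * n))%N by rewrite expn_gt0.
  by rewrite expnD; lia.
have h2 : (packing xs <= 2 ^ (n * n + 2))%N.
  have h3 : (n ^ n <= 2 ^ (n * n))%N by rewrite expnM; case: (n) n2 => // j; rewrite leq_exp2r.
  have h5 : (0 < 2 ^ (n * n))%N by rewrite expn_gt0.
  by rewrite /packing -/n expnD; lia.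
have h3 : (growth k xs <= 2 ^ (3 * n + 2 + (n * n + 2) * nexps k xs))%N.
  rewrite /growth -/n expnD leq_mul // expnM; case: (nexps k xs) => // j.
  by rewrite leq_exp2r.
apply: (@leq_ltn_trans (2 ^ ((n + 1) * (3 * n + 2 + (n * n + 2) * nexps k xs)))).
  by rewrite addn1 mulnC expnM leq_exp2r.
by rewrite ltn_exp2l // /word_size -/n; lia.
Qed.
End Resources.

(** * The scheme *)

Lemma bitlen_nth_le (x : seq int) j :
  (0 < input_size x)%N -> (`|nth 0%R x j| < 2 ^ input_size x)%N.
Proof.
move=> h; rewrite -bitlen_le //; case: (ltnP j (size x)) => hj; last first.
  by rewrite nth_default.
rewrite /input_size; elim: x j hj {h} => //= a x IH [|j] hj; first exact: leq_addr.
by apply: leq_trans (IH _ hj) (leq_addl _ _).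
Qed.

Lemma size_le_input_size (x : seq int) : (size x <= input_size x)%N.
Proof. by rewrite /input_size; elim: x => //= a x IH; rewrite -add1n leq_add. Qed.

(** * Reading back the encoded instance *)

Section Encoding.
Variables (k n : nat) (E : {set 'I_n * 'I_n}) (w : 'I_k -> 'I_n * 'I_n -> nat).
Variable eps : rat.
Hypothesis eps_gt0 : 0 < eps.
Local Notation x := (encode_instance E w eps).

Definition input_nat (x : seq int) (j : nat) : nat := `|nth 0%R x j|.

Let block_of (uv : 'I_n * 'I_n) : seq int :=
  (uv \in E : nat)%:Z :: [seq (if uv \in E then w i uv else 0%N)%:Z | i <- enum 'I_k].

Lemma encode_ge0 j : nth 0 x j = (input_nat x j)%:Z.
Proof.
rewrite /input_nat; apply/esym/gez0_abs.
have : all (fun z => 0 <= z) x.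
  rewrite /encode_instance /= numq_ge0 (ltW eps_gt0) denq_ge0 /=.
  apply/allP => z /flattenP [s /allpairsP [[u v] [_ _ ->]]] /=.
  by rewrite inE => /orP [/eqP -> //|/mapP [i _ ->]].
by case: (ltnP j (size x)) => hj; [move/all_nthP; apply|rewrite nth_default].
Qed.

Let nth_block (uv : 'I_n * 'I_n) (j : nat) : (j < k.+1)%N ->
  nth 0 x (3 + (@pair_index (input_nat x) uv * k.+1 + j)) = nth 0 (block_of uv) j.
Proof.
move=> jk; rewrite /encode_instance add3n /=.
have -> : [seq ((u, v) \in E : nat)%:Z ::
    [seq (if (u, v) \in E then w i (u, v) else 0%N)%:Z | i <- enum 'I_k]
    | u <- enum 'I_n, v <- enum 'I_n] = map block_of (all_pairs (input_nat x)).
  by rewrite /all_pairs map_allpairs.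
rewrite (@nth_flatten_const _ 0 _ k.+1) //; last first.
  by apply/allP => _ /mapP [ab _ ->]; rewrite /= size_map size_enum_ord.
rewrite (nth_map uv); last by rewrite size_all_pairs pair_index_lt.
by rewrite nth_all_pairs.
Qed.

Lemma encode_edge_bit (uv : 'I_n * 'I_n) :
  edge_bit k (input_nat x) (@pair_index (input_nat x) uv) = (uv \in E).
Proof.
by apply/eqP; rewrite -eqz_nat -encode_ge0 -[X in nth _ _ X]addn0 -addnA nth_block.
Qed.

Lemma encode_edge_wt (uv : 'I_n * 'I_n) (i : 'I_k) : uv \in E ->
  edge_wt k (input_nat x) (@pair_index (input_nat x) uv) i = w i uv.
Proof.
move=> h; apply/eqP; rewrite -eqz_nat /edge_wt -encode_ge0.
have e4 a : (4 + a + i = 3 + (a + i.+1))%N by rewrite addnS -addSn -addnA addSnnS.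
rewrite e4 nth_block ?ltnS //.
by rewrite /= h (nth_map i) ?size_enum_ord // nth_ord_enum.
Qed.

Lemma encode_n_le : (n <= input_size x)%N.
Proof.
apply: leq_trans (size_le_input_size _).
have -> : size x = (3 + n * n * k.+1)%N.
  rewrite /encode_instance /= add3n; congr _.+3.
  have -> : [seq ((u, v) \in E : nat)%:Z ::
    [seq (if (u, v) \in E then w i (u, v) else 0%N)%:Z | i <- enum 'I_k]
    | u <- enum 'I_n, v <- enum 'I_n] = map block_of (all_pairs (input_nat x)).
    by rewrite /all_pairs map_allpairs.
  rewrite -(size_all_pairs (input_nat x)); elim: (all_pairs _) => //= ab l IH.
  by rewrite size_cat IH size_map size_enum_ord -addSn -mulSn.
nia.
Qed.

Lemma encode_size_gt0 : (0 < input_size x)%N. Proof. by []. Qed.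


Lemma encode_numq_gt0 : (0 < input_nat x 0)%N.
Proof. by rewrite /input_nat /= absz_gt0 numq_eq0 gt_eqF. Qed.

Lemma encode_denq_gt0 : (0 < input_nat x 1)%N.
Proof. by rewrite /input_nat /= absz_gt0 denq_eq0. Qed.

Lemma encode_eps : eps = (input_nat x 0)%:R / (input_nat x 1)%:R.
Proof.
rewrite -[LHS]divq_num_den /input_nat /=.
by rewrite !pmulrn !gez0_abs ?denq_ge0 // numq_ge0 ltW.
Qed.
End Encoding.

Lemma label_bits_le_run k xs sz :
  (xs 2 * xs 2 * up_log 2 (min_labels k xs) <= run_cost k xs sz)%N.
Proof.
rewrite /run_cost; apply: leq_trans (leq_addl _ _); rewrite leq_mul2l.
apply/orP; right; apply: leq_trans (leq_addl _ _).
apply: (@leq_trans (min_labels k xs)); last by lia.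
by apply: up_log_min => //; apply: ltnW; apply: ltn_expl.
Qed.

Section Run.
Variables (k : nat) (x : seq int) (xs : nat -> nat).
Hypothesis xE : forall j, nth 0 x j = (xs j)%:Z.
Hypothesis x_size : (0 < input_size x)%N.
Local Notation n := (xs 2).
Local Notation t := (run_cost k xs (input_size x)).

Lemma acc_outputs (r : t.-tuple bool) : outputs_within x (acc_cmd k) r t
  (flatten (map (round_output k xs (labels_of k xs r)) (iota 0 (nscales k xs)))).
Proof.
pose b := word_size k xs (input_size x); pose N := rounds k xs.
have x_bound j : (`|nth 0%R x j| < 2 ^ b)%N.
  apply: leq_trans (bitlen_nth_le _ x_size) _; rewrite leq_exp2l // /b /word_size.
  exact: leq_addl.
have Nb : (N < 2 ^ b)%N.
  apply: leq_trans (ltn_expl N (ltnSn 1)) _; rewrite leq_exp2l // /b /word_size -/N.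
  by rewrite -addnA addnCA leq_addr.
have b0 : (0 < b)%N by rewrite /b /word_size; lia.
have wpA : wpre x b N (acc_cmd k) (fun s => output s =
      flatten (map (round_output k xs (labels_of k xs r)) (iota 0 (nscales k xs))))
    (State (fun=> 0) r [::]).
  apply: acc_spec => //.
  - by move=> j; have := x_bound j; rewrite xE.
  - exact: growth_lt.
  - by rewrite /N /rounds; lia.
  - by rewrite /N /rounds; lia.
  - by rewrite /N /rounds; lia.
  - by rewrite /N /rounds; lia.
  - by rewrite /N /rounds; lia.
  - by rewrite /N /rounds; lia.
  - by rewrite size_tuple label_bits_le_run.
have [|t' [s' [ex le_t _ ho]]] := wp_exec b0 x_bound _ wpA.
  by move=> a; rewrite /= expn_gt0.
by exists t', s'; split=> //; apply: leq_trans le_t (leq_addr _ _).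
Qed.
End Run.

Section Main.
Variables (k : nat) (xs : nat -> nat).
Local Notation p := (xs 0).
Local Notation q := (xs 1).
Local Notation n := (xs 2).
Variables (E : {set 'I_n * 'I_n}) (w : 'I_k -> 'I_n * 'I_n -> nat).
Hypothesis p_gt0 : (0 < p)%N.
Hypothesis q_gt0 : (0 < q)%N.
Hypothesis edge_bitP : forall uv, edge_bit k xs (pair_index uv) = (uv \in E).
Hypothesis edge_wtP : forall uv (i : 'I_k), uv \in E ->
  edge_wt k xs (pair_index uv) i = w i uv.

(** The given cover itself need not be printed: the member of least label in its profile class is,
    and equal profiles make it at most 1 + p/q times as heavy in every objective. *)
Lemma good_draw_pareto t (r : t.-tuple bool) : good_draw k xs r ->
  is_approx_pareto (is_cycle_cover E) (fun i => edges_weight (w i))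
    (1 + p%:R / q%:R) [set:: [seq [set:: l] | l <- outputs k xs (labels_of k xs r)]].
Proof.
move=> hg; set rr := labels_of k xs r.
have rr_lt e : (rr e < 2 * min_labels k xs + 1)%N.
  by apply: leq_trans (bin_val_lt _) _; rewrite size_mkseq label_bits_exp_le.
split=> [y|z /cycle_cover_perm [sz -> sub]].
  exact: (outputs_feasible edge_bitP).
have [c [hc lz approx]] := exists_scale p_gt0 q_gt0 edge_bitP edge_wtP sub.
have [sg hsg pe] := good_lightest hg hc lz.
exists (perm_edges sg).
  apply: (outputs_mem hc (perm_exponent_lt (proj1 hsg) rr_lt)) => u v.
  exact: lightest_flag.
move=> i; have := approx sg (proj1 hsg) pe i.
rewrite /edges_weight !big_perm_edges; set a := (\sum_u _)%N; set a' := (\sum_u _)%N => h.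
have q0 : 0 < q%:R :> rat by rewrite ltr0n.
rewrite -(ler_pM2l q0) mulrA mulrDr mulr1 mulrCA divff ?gt_eqF // mulr1.
by rewrite -natrD -!natrM ler_nat.
Qed.
End Main.

Theorem theorem3 (k : nat) (hk : (1 <= k)%N) :
  exists A : cmd, is_fpras_acc k A.
Proof.
exists (acc_cmd k); have [c [d cost_le]] := run_cost_poly k.
(* With y = size + 1/eps, each of the four summands of [measure] is at most y^3, so a bound c
   measure^d becomes c 4^d y^(3d). The cube comes from cap <= n^2 / eps. *)
exists (c * 4 ^ d)%N, (3 * d)%N => n E w eps eps0 x.
pose xs := input_nat x; pose t := run_cost k xs (input_size x).
have xE : forall j, nth 0 x j = (xs j)%:Z := encode_ge0 E w eps0.
have x0 : (0 < input_size x)%N := encode_size_gt0 E w eps.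
have edge_bitP := @encode_edge_bit k n E w eps eps0.
have edge_wtP := @encode_edge_wt k n E w eps eps0.
have p0 := encode_numq_gt0 E w eps0; have q0 := encode_denq_gt0 E w eps.
have epsE := encode_eps E w eps0.
have tle := label_bits_le_run k xs (input_size x).
set y := (input_size x)%:R + eps^-1.
exists t; split.
- have y_ge : (input_size x)%:R <= y by rewrite lerDl invr_ge0 ltW.
  have y1 : 1 <= y by apply: le_trans y_ge; rewrite ler1n.
  have n_le : n%:R <= y by apply: le_trans y_ge; rewrite ler_nat encode_n_le.
  have y3 : y <= y ^+ 3 by apply: ler_eXnr.
  have cap_le : (cap xs)%:R <= y ^+ 3.
    apply: (@le_trans _ _ (n%:R * n%:R * eps^-1)).
      rewrite epsE invf_div mulrA ler_pdivlMr ?ltr0n // -!natrM ler_nat.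
      exact: leq_trunc_div.
    rewrite exprS expr2 mulrA ler_pM ?mulr_ge0 ?invr_ge0 ?ler0n ?(ltW eps0) //.
      by rewrite ler_pM ?ler0n.
    by rewrite lerDr ler0n.
  have m_le : (measure (xs, input_size x))%:R <= 4%:R * y ^+ 3.
    have -> : (measure (xs, input_size x))%:R = n%:R + (cap xs)%:R + (input_size x)%:R + 1 :> rat.
      by rewrite -!natrD natr1 /measure addn1.
    have : n%:R <= y ^+ 3 by apply: le_trans y3.
    have : (input_size x)%:R <= y ^+ 3 by apply: le_trans y3.
    have : 1 <= y ^+ 3 by apply: le_trans y3.
    by move: cap_le; lra.
  apply: (@le_trans _ _ (c * measure (xs, input_size x) ^ d)%N%:R).
    by rewrite ler_nat; apply: (cost_le (xs, input_size x)).
  rewrite !natrM -mulrA ler_wpM2l ?ler0n // !natrX exprM -exprMn.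
  by apply: lerXn2r; rewrite ?nnegrE ?ler0n ?mulr_ge0 ?ler0n ?exprn_ge0 // (le_trans _ y1).
- by move=> r; eexists; apply: acc_outputs.
have good_ok (r : t.-tuple bool) : good_draw k xs r -> exists o P,
    [/\ outputs_within x (acc_cmd k) r t o, encodes_family o P
      & is_approx_pareto (is_cycle_cover E) (fun i => edges_weight (w i)) (1 + eps) P].
  move=> hg; exists (flatten (map (round_output k xs (labels_of k xs r)) (iota 0 (nscales k xs)))).
  exists [set:: [seq [set:: l] | l <- outputs k xs (labels_of k xs r)]]; split.
  - exact: acc_outputs.
  - exact: outputs_encode.
  - by rewrite epsE; apply: good_draw_pareto.
rewrite /prob; set S := [set r | _].
have sub : ~: [set r | ~~ good_draw k xs r] \subset S.
  by apply/subsetP => r; rewrite !inE negbK => /good_ok h; apply/asboolP.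
have := card_bad_draw tle; have := subset_leq_card sub.
rewrite cardsCs setCK card_tuple card_bool => h1 h2.
have t0 : 0 < (2 ^ t)%:R :> rat by rewrite ltr0n expn_gt0.
rewrite ler_pdivlMr // mulrAC mul1r ler_pdivrMr // -natrM ler_nat.
by move: h1 h2; move: (2 ^ t)%N #|S| #|[set r | ~~ good_draw k xs r]|; lia.
Qed.
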